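(* The functor $M\mapsto\mathcal S_M$ is an equivalence of categories from the abelian category of étale $A[P_+]$-modules to the abelian category of $P$-equivariant sheaves of $A$-modules on $N$, with inverse the functor $\mathcal S\mapsto\mathcal S(N_0)$ of sections over $N_0$.
   Context: $A$ is a commutative ring. $P=N\rtimes L$ is a locally profinite group, semidirect product of closed subgroups $N$ (normal) and $L$; $N_0\subset N$ is an open profinite subgroup. $P$ acts on $N$ by $(nt).x=ntxt^{-1}$ ($n,x\in N$, $t\in L$). $L_+=\{t\in L:tN_0t^{-1}\subset N_0\}$, $L_-=L_+^{-1}$, $P_+=N_0L_+$, $P_-=P_+^{-1}$; for $t\in L_+$ the index of $tN_0t^{-1}$ in $N_0$ is finite. $s$ is an element of the centre of $L$ such that $L=L_-s^{\mathbb Z}$ and $(N_k:=s^kN_0s^{-k})_{k\in\mathbb Z}$ is a decreasing sequence with union $N$ and trivial intersection. An étale $A[P_+]$-module is an $A[P_+]$-module $M$ such that for each $t\in L_+$ the action $\varphi_t$ is injective and $M=\bigoplus_uu\varphi_t(M)$, $u$ over representatives of $N_0/tN_0t^{-1}$; $\psi_t$ is the left inverse of $\varphi_t$ vanishing on $u\varphi_t(M)$ for $u\in N_0\setminus tN_0t^{-1}$, and $P_-$ acts on $M$ by $(ut)^{-1}\mapsto\psi_t\circ u^{-1}$. $M^P=\{f:P\to M:f(bx)=bf(x)\ \forall b\in P_-,x\in P\}$ with $P$ acting by right translation; $\operatorname{ev}_0(f)=f(1)$; $\sigma_0(m)\in M^P$ is the element with value $nm$ at $n\in N_0$ and $0$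 on $N\setminus N_0$. $\operatorname{Res}:C_c^\infty(N,A)\to\operatorname{End}_A(M^P)$ is the unique $P$-equivariant $A$-linear map with $1_{N_0}\mapsto\sigma_0\circ\operatorname{ev}_0$ ($P$ acts on functions by $(bf)(x)=f(b^{-1}.x)$ and on endomorphisms by conjugation). $\mathcal S_M$ is the $P$-equivariant sheaf on $N$ whose sections on a compact open subset $U$ are $M_U:=\operatorname{Res}(1_U)(M^P)$, with restriction maps $\operatorname{Res}(1_V)|_{M_U}$ for $V\subset U$ and action $b:M_U\to M_{b.U}$ of $b\in P$ induced from that on $M^P$, extended uniquely to arbitrary open subsets. For a $P$-equivariant sheaf $\mathcal S$, $b\in P_+$ acts on $\mathcal S(N_0)$ by $\mathcal S(N_0)\xrightarrow{b}\mathcal S(b.N_0)\subset\mathcal S(N_0)$ (extension by zero). *)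

(* Defs.v *)
From HB Require Import structures.
From mathcomp Require Import all_boot all_order all_algebra.
From mathcomp Require Import all_classical prodnormedzmodule topology numfun.

Set Implicit Arguments.
Unset Strict Implicit.
Unset Printing Implicit Defensive.

Import GRing.Theory.

Local Open Scope classical_set_scope.
Local Open Scope ring_scope.
Local Open Scope group_scope.

Record category := Category {
  ob :> Type;
  hom : ob -> ob -> Type;
  idm : forall X, hom X X;
  comp : forall X Y Z, hom Y Z -> hom X Y -> hom X Z;
  comp1m : forall X Y (f : hom X Y), comp (idm Y) f = f;
  compm1 : forall X Y (f : hom X Y), comp f (idm X) = f;
  compmA : forall X Y Z T (f : hom Z T) (g : hom Y Z) (h : hom X Y),
    comp f (comp g h) = comp (comp f g) h }.

Arguments hom {c} X Y.
Arguments idm {c} X.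
Arguments comp {c X Y Z} f g.

Record functor (C D : category) := Functor {
  fob :> C -> D;
  fmor : forall X Y, hom X Y -> hom (fob X) (fob Y);
  fmor1 : forall X, fmor (idm X) = idm (fob X);
  fmorM : forall X Y Z (f : hom Y Z) (g : hom X Y),
    fmor (comp f g) = comp (fmor f) (fmor g) }.

Arguments fmor {C D} _ {X Y} _.

Definition isomorphism (C : category) (X Y : C) (f : hom X Y) : Prop :=
  exists g : hom Y X, comp g f = idm X /\ comp f g = idm Y.

Definition inverse_equivalences (C D : category)
    (F : functor C D) (G : functor D C) : Prop :=
  exists (eta : forall X : C, hom X (G (F X)))
         (eps : forall Y : D, hom (F (G Y)) Y),
    [/\ forall X X' (f : hom X X'),
          comp (fmor G (fmor F f)) (eta X) = comp (eta X') f,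
        forall Y Y' (f : hom Y Y'),
          comp f (eps Y) = comp (eps Y') (fmor F (fmor G f)),
        forall X, isomorphism (eta X)
      & forall Y, isomorphism (eps Y)].

(* Abelian categories in the form given by Freyd: the additive structure on
   the sets of morphisms is determined by the category, hence no structure
   has to be chosen. *)
Section Abelian.
Variable C : category.

Definition monic (X Y : C) (f : hom X Y) : Prop :=
  forall T (g h : hom T X), comp f g = comp f h -> g = h.

Definition epic (X Y : C) (f : hom X Y) : Prop :=
  forall T (g h : hom Y T), comp g f = comp h f -> g = h.

Definition zero_object (Z : C) : Prop :=
  forall X, (exists! f : hom X Z, True) /\ (exists! f : hom Z X, True).

Definition zero_morphism (X Y : C) (f : hom X Y) : Prop :=
  exists2 Z, zero_object Z & exists (g : hom Z Y) (h : hom X Z), f = comp g h.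

Definition is_product (X Y Q : C) (p : hom Q X) (q : hom Q Y) : Prop :=
  forall T (f : hom T X) (g : hom T Y),
    exists! u : hom T Q, comp p u = f /\ comp q u = g.

Definition is_coproduct (X Y Q : C) (p : hom X Q) (q : hom Y Q) : Prop :=
  forall T (f : hom X T) (g : hom Y T),
    exists! u : hom Q T, comp u p = f /\ comp u q = g.

Definition is_kernel (X Y K : C) (k : hom K X) (f : hom X Y) : Prop :=
  zero_morphism (comp f k) /\
  forall T (g : hom T X), zero_morphism (comp f g) ->
    exists! u : hom T K, comp k u = g.

Definition is_cokernel (X Y Q : C) (q : hom Y Q) (f : hom X Y) : Prop :=
  zero_morphism (comp q f) /\
  forall T (g : hom Y T), zero_morphism (comp g f) ->
    exists! u : hom Q T, comp u q = g.

Definition abelian : Prop :=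
  (exists Z : C, zero_object Z) /\
  (forall X Y : C, exists Q (p : hom Q X) (q : hom Q Y), is_product p q) /\
  (forall X Y : C, exists Q (p : hom X Q) (q : hom Y Q), is_coproduct p q) /\
  (forall (X Y : C) (f : hom X Y), exists K (k : hom K X), is_kernel k f) /\
  (forall (X Y : C) (f : hom X Y), exists Q (q : hom Y Q), is_cokernel q f) /\
  (forall (X Y : C) (f : hom X Y), monic f ->
     exists Z (g : hom Y Z), is_kernel f g) /\
  (forall (X Y : C) (f : hom X Y), epic f ->
     exists W (g : hom W X), is_cokernel f g).

End Abelian.

HB.mixin Record isTopGroup G of Group G & Topological G := {
  mulg_continuous : continuous (fun x : G * G => x.1 * x.2);
  invg_continuous : continuous (fun x : G => x^-1) }.

#[short(type="topGroupType")]
HB.structure Definition TopGroup :=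
  {G of isTopGroup G & Group G & Topological G}.

Definition subgroup (G : groupType) (H : set G) : Prop :=
  [/\ H 1, forall x y, H x -> H y -> H (x * y) & forall x, H x -> H x^-1].

Definition expgz (G : groupType) (x : G) (k : int) : G :=
  match k with Posz n => x ^+ n | Negz n => x ^- n.+1 end.

Definition conjset (G : groupType) (t : G) (H : set G) : set G :=
  [set t * x * t^-1 | x in H].

Definition locally_profinite (G : topGroupType) : Prop :=
  hausdorff_space G /\
  forall U : set G, nbhs 1 U ->
    exists K : set G, [/\ subgroup K, open K, compact K & K `<=` U].

(* A subgroup of a Hausdorff group is Hausdorff, hence the separation axiom is
   not repeated. *)
Definition profinite_subgroup (G : topGroupType) (H : set G) : Prop :=
  [/\ subgroup H, compact H & totally_disconnected H].

Definition semidirect_product (G : topGroupType) (N L : set G) : Prop :=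
  [/\ subgroup N /\ closed N,
      subgroup L /\ closed L,
      forall g, conjset g N `<=` N,
      N `&` L = [set 1]
    & forall g, exists n t, [/\ N n, L t & g = n * t]].

Definition open_in (T : topologicalType) (N U : set T) : Prop :=
  exists2 O : set T, open O & U = N `&` O.

(* Open subsets of the subspace [N] are represented as subsets of [T]; a subset
   of [N] is compact in [N] if and only if it is compact in [T]. *)
Record opens (T : topologicalType) (N : set T) := Opens {
  opens_set :> set T;
  opens_setP : open_in N opens_set }.

Record sheaf (A : comPzRingType) (T : topologicalType) (N : set T) := Sheaf {
  sec :> opens N -> lmodType A;
  res : forall U V : opens N, V `<=` U -> {linear sec U -> sec V};
  res_id : forall (U : opens N) (h : U `<=` U) x, res h x = x;
  res_comp : forall (U V W : opens N) (hV : V `<=` U) (hW : W `<=` V)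
    (h : W `<=` U) x, res hW (res hV x) = res h x;
  sheaf_glue : forall (U : opens N) (C : set (opens N))
    (CU : forall V : opens N, C V -> V `<=` U),
    U `<=` [set x | exists2 V : opens N, C V & (V : set T) x] ->
    forall s : (forall V : opens N, C V -> sec V),
    (forall (V W O : opens N) (CV : C V) (CW : C W)
       (hV : O `<=` V) (hW : O `<=` W), res hV (s V CV) = res hW (s W CW)) ->
    exists! x : sec U, forall (V : opens N) (CV : C V),
      res (CU V CV) x = s V CV }.

Arguments res {A T N} _ {U V} _.

Section Setup.
Variables (A : comPzRingType) (P : topGroupType) (N L : set P).

(* The [L]-component of an element of [P = N L]. *)
Definition lpart (b : P) : P := xget 1 [set t | L t /\ N (b * t^-1)].

(* For [b = n t] with [n] in [N] and [t] in [L], this is [n t x t^-1]; it is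
   used for [x] in [N]. *)
Definition dot (b x : P) : P := b * x * (lpart b)^-1.

Section Cone.
Variable N0 : set P.

Definition Lplus : set P := [set t | L t /\ conjset t N0 `<=` N0].
Definition Lminus : set P := [set t | Lplus t^-1].
Definition Pplus : set P :=
  [set b | exists u t, [/\ N0 u, Lplus t & b = u * t]].

Definition Nk (s : P) (k : int) : set P := conjset (expgz s k) N0.

Definition contracting (s : P) : Prop :=
  [/\ L s /\ (forall t, L t -> s * t = t * s),
      L = [set t | exists u k, Lminus u /\ t = u * expgz s k],
      forall k : int, Nk s (k + 1)%R `<=` Nk s k,
      N = \bigcup_(k in [set: int]) Nk s k
    & \bigcap_(k in [set: int]) Nk s k = [set 1]].

(* The action of the monoid [Pplus] is extended by zero to a function on [P]. *)
Record pmodule := PModule {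
  pcar :> lmodType A;
  pact : P -> {linear pcar -> pcar};
  pact1 : forall m, pact 1 m = m;
  pactM : forall b c m, Pplus b -> Pplus c -> pact (b * c) m = pact b (pact c m);
  pact_out : forall b m, ~ Pplus b -> pact b m = 0%R }.

Definition direct_sum (M : lmodType A) (J : seq P) (V : P -> set M) : Prop :=
  (forall m, exists2 c : P -> M, forall u, u \in J -> V u (c u)
                              & m = (\sum_(u <- J) c u)%R) /\
  (forall c : P -> M, (forall u, u \in J -> V u (c u)) ->
     (\sum_(u <- J) c u)%R = 0%R -> forall u, u \in J -> c u = 0%R).

Definition coset_representatives (t : P) (J : seq P) : Prop :=
  [/\ uniq J, forall u, u \in J -> N0 u
    & forall n, N0 n -> exists! u, u \in J /\ conjset t N0 (u^-1 * n)].

(* The direct sum does not depend on the choice of [J]; the existence of [J]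
   contains the finiteness of the index of [t N0 t^-1] in [N0]. *)
Definition etale (M : pmodule) : Prop :=
  forall t, Lplus t ->
    injective (pact M t) /\
    exists2 J, coset_representatives t J &
      direct_sum J (fun u => range (fun m : M => pact M u (pact M t m))).

(* For an etale [M] the conditions below determine [psi M t]; the default value
   of [xget] is not used. The same remark applies to [sigma0] and [Res]. *)
Definition psi (M : pmodule) (t : P) : {linear M -> M} :=
  xget (\0 : {linear M -> M}) [set p : {linear M -> M} |
    (forall m, p (pact M t m) = m) /\
    (forall u m, N0 u -> ~ conjset t N0 u -> p (pact M u (pact M t m)) = 0%R)].

Record etmod := EtMod { etmod_car :> pmodule; etmodP : etale etmod_car }.

Record ethom (M M' : etmod) := EtHom {
  ethom_fun :> {linear M -> M'};
  ethomP : forall b m, Pplus b ->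
    ethom_fun (pact M b m) = pact M' b (ethom_fun m) }.

Lemma linear_eqP (V W : lmodType A) (f g : {linear V -> W}) : f =1 g -> f = g.
Proof.
case: f g => [f cf] [g cg] /= /funext fg; subst g.
case: cf cg => [[a1] [a2]] [[b1] [b2]].
by rewrite (Prop_irrelevance a1 b1) (Prop_irrelevance a2 b2).
Qed.

Lemma ethom_eqP (M M' : etmod) (f g : ethom M M') : f =1 g -> f = g.
Proof.
case: f g => [f cf] [g cg] /= fg; have E := linear_eqP fg.
by subst g; congr EtHom; exact: Prop_irrelevance.
Qed.

Definition ethom_id (M : etmod) : ethom M M :=
  @EtHom M M idfun (fun _ _ _ => erefl).

Lemma ethom_comp_subproof (M M' M'' : etmod) (f : ethom M' M'') (g : ethom M M')
  b m : Pplus b -> (f \o g) (pact M b m) = pact M'' b ((f \o g) m).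
Proof. by move=> hb /=; rewrite !ethomP. Qed.

Definition ethom_comp (M M' M'' : etmod) (f : ethom M' M'') (g : ethom M M') :
    ethom M M'' :=
  @EtHom M M'' (f \o g) (ethom_comp_subproof f g).

Definition EtaleModules : category.
Proof.
refine (@Category etmod ethom ethom_id ethom_comp _ _ _);
  by move=> *; apply: ethom_eqP.
Defined.

Section Induced.
Variable M : pmodule.

(* [f(bx) = b f(x)] for [b = (u t)^-1] in [P_-], with [u] in [N0] and [t] in
   [Lplus]. *)
Definition is_induced (f : P -> M) : Prop :=
  forall u t x, N0 u -> Lplus t ->
    f ((u * t)^-1 * x) = psi M t (pact M u^-1 (f x)).

Definition induced : {pred (P -> M)} := fun f => `[< is_induced f >].

Lemma induced_submod_closed : submod_closed induced.
Proof.
split=> [|a f g /asboolP If /asboolP Ig]; apply/asboolP => u t x hu ht.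
  by rewrite /= !linear0.
by rewrite !fctE If // Ig // !linearP.
Qed.

HB.instance Definition _ :=
  GRing.isSubmodClosed.Build A (P -> M) induced induced_submod_closed.

Record MP := mkMP { MPval :> P -> M; MPvalP : MPval \in induced }.

HB.instance Definition _ := [isSub for MPval].
HB.instance Definition _ := [Choice of MP by <:].
HB.instance Definition _ := [SubChoice_isSubLmodule of MP by <:].

Lemma rtrans_subproof (b : P) (f : MP) : (fun x => f (x * b)) \in induced.
Proof.
by apply/asboolP => u t x hu ht; case: f => f /= /asboolP If;
  rewrite -mulgA If.
Qed.

Definition rtrans (b : P) (f : MP) : MP := mkMP (rtrans_subproof b f).

Definition ev0 (f : MP) : M := f 1.

Definition sigma0 (m : M) : MP := xget (0%R : MP) [set f : MP |
  (forall n, N0 n -> f n = pact M n m) /\ (forall n, N n -> ~ N0 n -> f n = 0%R)].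

End Induced.

End Cone.

(* Functions on [N] are extended by zero to [P]. *)
Definition is_Ccinf (f : P -> A^o) : Prop :=
  [/\ forall x, ~ N x -> f x = 0%R,
      forall x, N x -> exists2 U, open_in N U /\ U x & forall y, U y -> f y = f x
    & exists2 K, compact K /\ K `<=` N & forall x, ~ K x -> f x = 0%R].

Definition Ccinf_pred : {pred (P -> A^o)} := fun f => `[< is_Ccinf f >].

Lemma Ccinf_submod_closed : submod_closed Ccinf_pred.
Proof.
split=> [|a f g /asboolP[f1 f2 [Kf [cf Nf] f3]] /asboolP[g1 g2 [Kg [cg Ng] g3]]];
  apply/asboolP; split => //.
- by move=> x Nx; exists N => //; split=> //; exists setT; rewrite ?setIT //;
    exact: openT.
- by exists set0; [split=> //; exact: compact0|].
- by move=> x Nx; rewrite !fctE f1 // g1 // scaler0 addr0.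
- move=> x Nx; have [U [[O1 oO1 ->] [_ O1x]] fU] := f2 x Nx.
  have [V [[O2 oO2 ->] [_ O2x]] gV] := g2 x Nx.
  exists (N `&` (O1 `&` O2)); first by split=> //; exists (O1 `&` O2) => //;
    exact: openI.
  by move=> y [Ny [O1y O2y]]; rewrite !fctE fU // gV.
- exists (Kf `|` Kg); first by split; [exact: compactU | rewrite subUset].
  by move=> x /not_orP[nf ng]; rewrite !fctE f3 // g3 // scaler0 addr0.
Qed.

HB.instance Definition _ :=
  GRing.isSubmodClosed.Build A (P -> A^o) Ccinf_pred Ccinf_submod_closed.

Record Ccinf := mkCcinf { Ccval :> P -> A^o; CcvalP : Ccval \in Ccinf_pred }.

HB.instance Definition _ := [isSub for Ccval].
HB.instance Definition _ := [Choice of Ccinf by <:].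
HB.instance Definition _ := [SubChoice_isSubLmodule of Ccinf by <:].

(* [insubd 0 f] is [f] whenever [f] belongs to [C_c^oo(N, A)]. *)
Definition Ccind (U : set P) : Ccinf := insubd (0%R : Ccinf) (\1_U : P -> A^o).

Definition Ccact (b : P) (f : Ccinf) : Ccinf :=
  insubd (0%R : Ccinf) (fun x : P => f (dot b^-1 x)).

Section Res.
Variables (N0 : set P) (M : pmodule N0).

Definition is_Res (R : Ccinf -> {linear MP M -> MP M}) : Prop :=
  [/\ forall (a : A) f g m, R (a *: f + g)%R m = (a *: R f m + R g m)%R,
      forall b f m, R (Ccact b f) m = rtrans b (R f (rtrans b^-1 m))
    & forall m, R (Ccind N0) m = sigma0 (ev0 m)].

Definition Res : Ccinf -> {linear MP M -> MP M} :=
  xget (fun=> \0 : {linear MP M -> MP M}) [set R | is_Res R].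

End Res.

(* The equation [V = b.U] is an argument of [sact], so that [(bc).U] and
   [b.(c.U)] need not be identified by a transport. *)
Record eqsheaf := EqSheaf {
  shf :> sheaf A N;
  sact : forall (b : P) (U V : opens N), V = dot b @` U :> set P ->
    {linear shf U -> shf V};
  sact1 : forall (U : opens N) (h : U = dot 1 @` U :> set P) x, sact h x = x;
  sactM : forall (b c : P) (U V W : opens N) (hV : V = dot c @` U :> set P)
    (hW : W = dot b @` V :> set P) (h : W = dot (b * c) @` U :> set P) x,
    sact h x = sact hW (sact hV x);
  sact_res : forall (b : P) (U V U' V' : opens N)
    (h : V = dot b @` U :> set P) (h' : V' = dot b @` U' :> set P)
    (i : U' `<=` U) (j : V' `<=` V) x,
    res shf j (sact h x) = sact h' (res shf i x) }.

Arguments sact _ {b U V} _.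

Record eqshom (S S' : eqsheaf) := EqsHom {
  eqshom_fun :> forall U : opens N, {linear S U -> S' U};
  eqshom_res : forall (U V : opens N) (i : V `<=` U) x,
    eqshom_fun V (res S i x) = res S' i (eqshom_fun U x);
  eqshom_act : forall b (U V : opens N) (h : V = dot b @` U :> set P) x,
    eqshom_fun V (sact S h x) = sact S' h (eqshom_fun U x) }.

Lemma eqshom_eqP (S S' : eqsheaf) (f g : eqshom S S') :
  (forall U, f U =1 g U) -> f = g.
Proof.
case: f g => [f f1 f2] [g g1 g2] /= fg.
have E : f = g by apply: functional_extensionality_dep => U; exact/linear_eqP/fg.
by subst g; congr EqsHom; exact: Prop_irrelevance.
Qed.

Definition eqshom_id (S : eqsheaf) : eqshom S S :=
  @EqsHom S S (fun=> idfun) (fun _ _ _ _ => erefl) (fun _ _ _ _ _ => erefl).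

Section EqshomComp.
Variables (S S' S'' : eqsheaf) (f : eqshom S' S'') (g : eqshom S S').

Lemma eqshom_comp_res (U V : opens N) (i : V `<=` U) x :
  (f V \o g V) (res S i x) = res S'' i ((f U \o g U) x).
Proof. by rewrite /= !eqshom_res. Qed.

Lemma eqshom_comp_act b (U V : opens N) (h : V = dot b @` U :> set P) x :
  (f V \o g V) (sact S h x) = sact S'' h ((f U \o g U) x).
Proof. by rewrite /= !eqshom_act. Qed.

Definition eqshom_comp : eqshom S S'' :=
  @EqsHom S S'' (fun U => f U \o g U) eqshom_comp_res eqshom_comp_act.

End EqshomComp.

Definition EquivariantSheaves : category.
Proof.
refine (@Category eqsheaf eqshom eqshom_id eqshom_comp _ _ _);
  by move=> *; apply: eqshom_eqP.
Defined.

Section Functors.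
Variable N0 : opens N.

(* [i] identifies the sections of [S] over the compact open subsets [U] of [N]
   with [M_U = Res(1_U)(M^P)], compatibly with restrictions and the action of
   [P]. Since compact open subsets form a basis of the topology of [N], this
   says that [S] is [S_M]. *)
Definition is_SM (M : etmod N0) (S : eqsheaf)
    (i : forall U : opens N, compact U -> {linear S U -> MP M}) : Prop :=
  [/\ forall (U : opens N) (cU : compact U), injective (i U cU),
      forall (U : opens N) (cU : compact U),
        range (i U cU) = range (Res M (Ccind U)),
      forall (U V : opens N) (cU : compact U) (cV : compact V)
        (h : V `<=` U) x, i V cV (res S h x) = Res M (Ccind V) (i U cU x)
    & forall b (U V : opens N) (cU : compact U) (cV : compact V)
        (h : V = dot b @` U :> set P) x,
        i V cV (sact S h x) = rtrans b (i U cU x)].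

(* On morphisms, the functor [M |-> S_M] is induced by composition
   [M^P -> M'^P]. *)
Definition is_SM_functor (F : functor (EtaleModules N0) EquivariantSheaves) :
    Prop :=
  exists i : forall (M : EtaleModules N0) (U : opens N), compact U ->
      {linear (F M : eqsheaf) U -> MP (M : etmod N0)},
    (forall M : EtaleModules N0, is_SM (i M)) /\
    (forall (M M' : EtaleModules N0) (f : hom M M') (U : opens N)
       (cU : compact U) (x : (F M : eqsheaf) U) (p : P),
       i M' U cU ((fmor F f : eqshom _ _) U x) p =
       (f : ethom M M') (i M U cU x p)).

(* [j] identifies [M] with [S(N0)], on which [b] in [Pplus] sends [x] to the
   extension by zero of its image in [S(b.N0)]. *)
Definition is_sections (S : eqsheaf) (M : etmod N0) (j : {linear M -> S N0}) :
    Prop :=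
  bijective j /\
  forall b m, Pplus N0 b ->
    (forall (V : opens N) (h : V = dot b @` N0 :> set P) (hV : V `<=` N0),
       res S hV (j (pact M b m)) = sact S h (j m)) /\
    (forall (V : opens N) (hV : V `<=` N0), V `&` (dot b @` N0) = set0 ->
       res S hV (j (pact M b m)) = 0%R).

Definition is_sections_functor
    (G : functor EquivariantSheaves (EtaleModules N0)) : Prop :=
  exists j : forall S : EquivariantSheaves,
      {linear (G S : etmod N0) -> (S : eqsheaf) N0},
    (forall S : EquivariantSheaves, is_sections (j S)) /\
    (forall (S S' : EquivariantSheaves) (f : hom S S') (x : (G S : etmod N0)),
       j S' ((fmor G f : ethom _ _) x) = (f : eqshom S S') N0 (j S x)).

End Functors.

End Setup.

(* Main.v *)
Require Import Defs.
From HB Require Import structures.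
From mathcomp Require Import all_boot all_order all_algebra.
From mathcomp Require Import all_classical topology numfun.
Import Defs.

(** Let [b.U] be the image of a subset [U] of [N] under the action of [P], and
    call [b.N0] the ball of [b]. Everything rests on two observations: the ball
    of [b] is contained in the ball of [c] exactly when [c^-1 * b] lies in
    [Pplus] ([PplusP], [ball_subP]), and the balls of the elements [x * s ^+ k],
    with [x] in [N], form a basis of the topology of [N] ([ball_basis]). Hence a
    section of an equivariant sheaf over an open subset [U] can be stored as a
    function [G] on [P]: for each ball of [c] contained in [U], restrict the
    section to this ball and move it to [N0] by [c^-1]. Restriction from the
    ball of [c] to that of [c * p], with [p] in [Pplus], becomes a map on
    sections over [N0] that is left inverse to the action of [p].

    On an etale module [M] this map exists algebraically: it is [contract p],
    that is, [psi] composed with a translation. So the sheaf of [M] is defined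
    by families [G] with [G (c * p) = contract p (G c)] ([is_germ]); restriction
    is truncation, and [P] acts by translation of the argument. The
    decomposition of [M] along the cosets of [s^k N0 s^-k] in [N0] says that [M]
    is glued from its contractions at any fixed radius [k]
    ([contract_separated], [contract_glue]). As balls are compact, any covering
    is refined by the balls of some fixed radius ([ball_lebesgue]), and local
    data extend uniquely ([germ_eq], [germ_extend]); this gives the sheaf axiom.

    Up to replacing the argument by its inverse, the families over [N] are the
    elements of [MP M] ([induced_germP]). Multiplication of such sections by
    locally constant functions has the properties that define [Res], and any
    operator with these properties agrees with it on indicator functions of
    compact open sets, since these are finite sums of translates of that of
    [N0] ([multiply_is_Res], [agrees_ind]). Extension by zero then identifies
    the sections over a compact open [U] with the image of [Res] at [U].

    In the other direction, for an equivariant sheaf [S], extension by zero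
    makes [S N0] a module over [Pplus]. It is etale because, for [t] in [Lplus],
    [N0] is the disjoint union of the balls of the elements [u * t], where [u]
    runs through representatives of the cosets of [t N0 t^-1]; its contractions
    are restriction followed by transport ([section_etale], [contract_section]).
    The unit sends [m] to the family [contract c m] and the counit is inverse to
    the map that stores a section as a family; both are bijective.

    Kernels, cokernels and biproducts of etale modules are computed on the
    underlying modules, because morphisms commute with [psi]
    ([etale_abelian]). Equivariant sheaves then form an abelian category by
    transport along the equivalence ([abelian_equivalence]), which avoids
    sheafifying quotients. *)

Set Implicit Arguments.
Unset Strict Implicit.
Unset Printing Implicit Defensive.

Import GRing.Theory.

Local Open Scope classical_set_scope.
Local Open Scope ring_scope.

(** * Transport of abelian categories along an equivalence *)

Section FullyFaithful.
Variables (C D : category) (H : functor D C).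

Definition faithful : Prop :=
  forall Y Y' (f g : hom Y Y'), fmor H f = fmor H g -> f = g.

Definition full : Prop :=
  forall Y Y' (h : hom (H Y) (H Y')), exists f : hom Y Y', fmor H f = h.

Definition essentially_surjective : Prop :=
  forall X : C, exists Y (a : hom X (H Y)), isomorphism a.

Hypotheses (faithH : faithful) (fullH : full) (surjH : essentially_surjective).

Lemma zero_object_reflect (Z : D) : zero_object (H Z) -> zero_object Z.
Proof.
move=> zZ Y; have [[f [_ uf]] [g [_ ug]]] := zZ (H Y).
have [f' Ef] := fullH f; have [g' Eg] := fullH g.
split; [exists f'|exists g']; split=> // h _; apply: faithH.
- by rewrite Ef; exact: uf.
- by rewrite Eg; exact: ug.
Qed.

Lemma zero_object_iso (X Y : C) (a : hom X Y) :
  isomorphism a -> zero_object X -> zero_object Y.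
Proof.
case=> b [ba ab] zX T; have [[f [_ uf]] [g [_ ug]]] := zX T.
split.
- exists (comp a f); split=> // h _.
  by rewrite (uf (comp b h)) // compmA ab comp1m.
- exists (comp g b); split=> // h _.
  by rewrite (ug (comp h a)) // -compmA ab compm1.
Qed.

Lemma zero_object_image (Z : D) : zero_object Z -> zero_object (H Z).
Proof.
move=> zZ X; have [Y [a [b [ba ab]]]] := surjH X.
have [[f [_ uf]] [g [_ ug]]] := zZ Y; split.
- exists (comp (fmor H f) a); split=> // h _.
  have [h' Eh] := fullH (comp h b).
  by rewrite (uf h') // Eh -compmA ba compm1.
- exists (comp b (fmor H g)); split=> // h _.
  have [h' Eh] := fullH (comp a h).
  by rewrite (ug h') // Eh compmA ba comp1m.
Qed.

(** A zero object of [C] through which [fmor H f] factors is isomorphic to the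
    image of an object of [D], which is then a zero object. *)
Lemma zero_morphism_image (Y Y' : D) (f : hom Y Y') :
  zero_morphism (fmor H f) <-> zero_morphism f.
Proof.
split=> [[X zX [g [h E]]]|[Z zZ [g [h ->]]]]; last first.
  exists (H Z); first exact: zero_object_image.
  by exists (fmor H g), (fmor H h); rewrite fmorM.
have [Z [a ia]] := surjH X.
have zHZ := zero_object_iso ia zX.
case: ia => b [ba ab].
have [g' Eg] := fullH (comp g b); have [h' Eh] := fullH (comp a h).
exists Z; first exact: zero_object_reflect.
exists g', h'; apply: faithH; rewrite fmorM Eg Eh E.
by rewrite -compmA (compmA b) ba comp1m.
Qed.

Lemma zero_morphism_compl (X Y Z : C) (f : hom Y Z) (g : hom X Y) :
  zero_morphism g -> zero_morphism (comp f g).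
Proof.
by case=> O zO [u [v ->]]; exists O => //; exists (comp f u), v; rewrite compmA.
Qed.

Lemma zero_morphism_compr (X Y Z : C) (f : hom Y Z) (g : hom X Y) :
  zero_morphism f -> zero_morphism (comp f g).
Proof.
by case=> O zO [u [v ->]]; exists O => //; exists u, (comp v g); rewrite compmA.
Qed.

Lemma product_reflect (X Y Q : D) (p : hom Q X) (q : hom Q Y) :
  is_product (fmor H p) (fmor H q) -> is_product p q.
Proof.
move=> pr T f g; have [u [[pu qu] uu]] := pr _ (fmor H f) (fmor H g).
have [v Ev] := fullH u; exists v; split.
  by split; apply: faithH; rewrite fmorM Ev.
by move=> w [pw qw]; apply: faithH; rewrite Ev; apply: uu; rewrite -!fmorM pw qw.
Qed.

Lemma coproduct_reflect (X Y Q : D) (p : hom X Q) (q : hom Y Q) :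
  is_coproduct (fmor H p) (fmor H q) -> is_coproduct p q.
Proof.
move=> pr T f g; have [u [[pu qu] uu]] := pr _ (fmor H f) (fmor H g).
have [v Ev] := fullH u; exists v; split.
  by split; apply: faithH; rewrite fmorM Ev.
by move=> w [pw qw]; apply: faithH; rewrite Ev; apply: uu; rewrite -!fmorM pw qw.
Qed.

Lemma kernel_reflect (X Y K : D) (k : hom K X) (f : hom X Y) :
  is_kernel (fmor H k) (fmor H f) -> is_kernel k f.
Proof.
case=> z kP; split; first by rewrite -zero_morphism_image fmorM.
move=> T g zg; have [|u [ku uu]] := kP _ (fmor H g).
  by rewrite -fmorM zero_morphism_image.
have [v Ev] := fullH u; exists v; split.
  by apply: faithH; rewrite fmorM Ev.
by move=> w kw; apply: faithH; rewrite Ev; apply: uu; rewrite -fmorM kw.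
Qed.

Lemma cokernel_reflect (X Y Q : D) (q : hom Y Q) (f : hom X Y) :
  is_cokernel (fmor H q) (fmor H f) -> is_cokernel q f.
Proof.
case=> z kP; split; first by rewrite -zero_morphism_image fmorM.
move=> T g zg; have [|u [ku uu]] := kP _ (fmor H g).
  by rewrite -fmorM zero_morphism_image.
have [v Ev] := fullH u; exists v; split.
  by apply: faithH; rewrite fmorM Ev.
by move=> w kw; apply: faithH; rewrite Ev; apply: uu; rewrite -fmorM kw.
Qed.

(** Test objects in [C] may be replaced by isomorphic ones in the image of [H],
    and then the test takes place in [D]. *)
Lemma monic_image (X Y : D) (f : hom X Y) : monic f -> monic (fmor H f).
Proof.
move=> mf T g h; have [T' [a [b [ba ab]]]] := surjH T.
have [g' Eg] := fullH (comp g b); have [h' Eh] := fullH (comp h b).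
move=> E; have {}E : g' = h'.
  by apply: mf; apply: faithH; rewrite !fmorM Eg Eh !compmA E.
have /(congr1 (fun t => comp t a)) : comp g b = comp h b by rewrite -Eg -Eh E.
by rewrite -!compmA ba !compm1.
Qed.

Lemma epic_image (X Y : D) (f : hom X Y) : epic f -> epic (fmor H f).
Proof.
move=> mf T g h; have [T' [a [b [ba ab]]]] := surjH T.
have [g' Eg] := fullH (comp a g); have [h' Eh] := fullH (comp a h).
move=> E; have {}E : g' = h'.
  by apply: mf; apply: faithH; rewrite !fmorM Eg Eh -!compmA E.
have /(congr1 (comp b)) : comp a g = comp a h by rewrite -Eg -Eh E.
by rewrite !compmA ba !comp1m.
Qed.

(** Every notion occurring in [abelian] is reflected by [H]; it remains to
    replace the objects that [abelian C] provides by isomorphic ones in the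
    image of [H]. *)
Lemma abelian_reflect : abelian C -> abelian D.
Proof.
case=> [[Z zZ] [prodC [coprodC [kerC [cokerC [monoC epiC]]]]]].
split; [|split; [|split; [|split; [|split; [|split]]]]].
- have [Y [a ia]] := surjH Z; exists Y.
  exact/zero_object_reflect/(zero_object_iso ia).
- move=> X Y; have [Q [p [q pq]]] := prodC (H X) (H Y).
  have [Q' [a [b [ba ab]]]] := surjH Q.
  have [p' Ep] := fullH (comp p b); have [q' Eq] := fullH (comp q b).
  exists Q', p', q'; apply: product_reflect; rewrite Ep Eq => T f g.
  have [u [[pu qu] uu]] := pq _ f g; exists (comp a u); split.
    by split; rewrite -compmA (compmA b) ba comp1m.
  move=> v [pv qv]; rewrite (uu (comp b v)); last by rewrite !compmA.
  by rewrite compmA ab comp1m.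
- move=> X Y; have [Q [p [q pq]]] := coprodC (H X) (H Y).
  have [Q' [a [b [ba ab]]]] := surjH Q.
  have [p' Ep] := fullH (comp a p); have [q' Eq] := fullH (comp a q).
  exists Q', p', q'; apply: coproduct_reflect; rewrite Ep Eq => T f g.
  have [u [[pu qu] uu]] := pq _ f g; exists (comp u b); split.
    by split; rewrite -compmA (compmA b) ba comp1m.
  move=> v [pv qv]; rewrite (uu (comp v a)); last by rewrite -!compmA.
  by rewrite -compmA ab compm1.
- move=> X Y f; have [K [k [z kP]]] := kerC _ _ (fmor H f).
  have [K' [a [b [ba ab]]]] := surjH K.
  have [k' Ek] := fullH (comp k b).
  exists K', k'; apply: kernel_reflect; rewrite Ek; split.
    by rewrite compmA; exact: zero_morphism_compr.
  move=> T g zg; have [u [ku uu]] := kP _ g zg; exists (comp a u); split.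
    by rewrite -compmA (compmA b) ba comp1m.
  move=> v kv; rewrite (uu (comp b v)); last by rewrite compmA.
  by rewrite compmA ab comp1m.
- move=> X Y f; have [K [k [z kP]]] := cokerC _ _ (fmor H f).
  have [K' [a [b [ba ab]]]] := surjH K.
  have [k' Ek] := fullH (comp a k).
  exists K', k'; apply: cokernel_reflect; rewrite Ek; split.
    by rewrite -compmA; exact: zero_morphism_compl.
  move=> T g zg; have [u [ku uu]] := kP _ g zg; exists (comp u b); split.
    by rewrite -compmA (compmA b) ba comp1m.
  move=> v kv; rewrite (uu (comp v a)); last by rewrite -compmA.
  by rewrite -compmA ab compm1.
- move=> X Y f /monic_image/monoC [Z' [g [z kP]]].
  have [W [a [b [ba ab]]]] := surjH Z'; have [g' Eg] := fullH (comp a g).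
  exists W, g'; apply: kernel_reflect; rewrite Eg; split.
    by rewrite -compmA; exact: zero_morphism_compl.
  move=> T h; rewrite -compmA => /(@zero_morphism_compl _ _ _ b).
  by rewrite compmA ba comp1m; exact: kP.
- move=> X Y f /epic_image/epiC [Z' [g [z kP]]].
  have [W [a [b [ba ab]]]] := surjH Z'; have [g' Eg] := fullH (comp g b).
  exists W, g'; apply: cokernel_reflect; rewrite Eg; split.
    by rewrite compmA; exact: zero_morphism_compr.
  move=> T h; rewrite compmA => /(@zero_morphism_compr _ _ _ _ a).
  by rewrite -compmA ba compm1; exact: kP.
Qed.

End FullyFaithful.

(** The inverse functor [G] of an equivalence is fully faithful: by the
    naturality of [eps] it is faithful, as is [F] by that of [eta]; and a
    morphism [h] from [G Y] to [G Y'] is the image of the conjugate of [F h]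
    by [eps]. *)
Lemma abelian_equivalence (C D : category) (F : functor C D) (G : functor D C) :
  inverse_equivalences F G -> abelian C -> abelian D.
Proof.
case=> eta [eps [eta_nat eps_nat eta_iso eps_iso]].
have faithG : faithful G.
  move=> Y Y' f g E; have [b [_ eb]] := eps_iso Y.
  rewrite -[f]compm1 -[g]compm1 -eb !compmA.
  by congr comp; rewrite !eps_nat E.
have faithF : faithful F.
  move=> X X' f g E; have [b [be _]] := eta_iso X'.
  rewrite -[f]comp1m -[g]comp1m -be -!compmA.
  by congr comp; rewrite -!eta_nat E.
apply: (abelian_reflect faithG) => [Y Y' h|X].
  have [b [be eb]] := eps_iso Y; have [b' [be' eb']] := eps_iso Y'.
  exists (comp (eps Y') (comp (fmor F h) b)).
  apply: faithF; rewrite -[LHS]comp1m -be' -compmA -eps_nat.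
  by rewrite !compmA be' comp1m -compmA be compm1.
by exists (F X), (eta X).
Qed.


(** * Linear maps, submodules and quotient modules *)

Section LinearMaps.
Variable A : comPzRingType.

Definition mk_linear (V W : lmodType A) (f : V -> W) (hf : linear f) :
    {linear V -> W} :=
  HB.pack_for {linear V -> W} f (GRing.isLinear.Build A V W *:%R f hf).

(** Lifting along an injection and factoring through a surjection: the values
    are chosen, and linearity follows from the uniqueness of the choice. *)
Lemma lift_linear (K V T : lmodType A) (i : {linear K -> V})
    (f : {linear T -> V}) :
  injective i -> (forall x, exists y, i y = f x) ->
  exists g : {linear T -> K}, forall x, i (g x) = f x.
Proof.
move=> inji /choice[g gP].
have lg : linear g by move=> a x y; apply: inji; rewrite linearP !gP linearP.
by exists (mk_linear lg).
Qed.

Lemma factor_linear (V Q W : lmodType A) (p : {linear V -> Q})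
    (f : {linear V -> W}) :
  (forall y, exists x, p x = y) -> (forall x, p x = 0 -> f x = 0) ->
  exists g : {linear Q -> W}, forall x, g (p x) = f x.
Proof.
move=> /choice[r rP] pf.
have frp x : f (r (p x)) = f x.
  by apply/eqP; rewrite -subr_eq0 -linearB pf // linearB /= rP subrr.
have lg : linear (f \o r).
  by move=> a x y /=; rewrite -linearP -[RHS]frp linearP !rP.
by exists (mk_linear lg) => x /=.
Qed.

Lemma inverse_linear (V W : lmodType A) (f : {linear V -> W}) :
  bijective f -> exists g : {linear W -> V}, cancel f g /\ cancel g f.
Proof.
move=> bf; have [g fg] : exists g : {linear W -> V}, forall x, f (g x) = idfun x.
  by apply: lift_linear (bij_inj bf) _ => x; case: bf => h _ hf; exists (h x).
by exists g; split=> // x; apply: (bij_inj bf); rewrite fg.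
Qed.

Section SubQuotient.
Variables (V : lmodType A) (S : V -> Prop).

Definition submodule_property : Prop :=
  S 0 /\ forall a x y, S x -> S y -> S (a *: x + y).

(** The proof [h] is an argument of the predicate so that its closure properties
    can be inferred from its shape. *)
Definition submodule_pred (h : submodule_property) : {pred V} :=
  fun x => `[< S x >].

Variable hS : submodule_property.

Lemma submodule_pred_closed : submod_closed (submodule_pred hS).
Proof.
case: (hS) => S0 SD; split; first exact/asboolP.
by move=> a x y /asboolP Sx /asboolP Sy; apply/asboolP/SD.
Qed.

HB.instance Definition _ :=
  GRing.isSubmodClosed.Build A V (submodule_pred hS) submodule_pred_closed.

Record submodule := Submodule
  { submodule_val :> V; submodule_valP : submodule_val \in submodule_pred hS }.

HB.instance Definition _ := [isSub for submodule_val].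
HB.instance Definition _ := [Choice of submodule by <:].
HB.instance Definition _ := [SubChoice_isSubLmodule of submodule by <:].

Definition quotient_module := Quotient.quot (submodule_pred hS).

HB.instance Definition _ := GRing.Zmodule.on quotient_module.

Local Notation proj := (\pi_quotient_module)%qT.

Lemma proj_eqP x y : proj x = proj y <-> S (x - y).
Proof.
split=> [/eqP|h]; first by rewrite -Quotient.idealrBE => /asboolP.
by apply/eqP; rewrite -Quotient.idealrBE; apply/asboolP.
Qed.

Definition quotient_scale (a : A) (x : quotient_module) : quotient_module :=
  proj (a *: repr x).

Lemma quotient_scaleE a x : quotient_scale a (proj x) = proj (a *: x).
Proof.
apply/proj_eqP; rewrite -scalerBr -[_ *: _]addr0.
have [S0 SD] := hS; apply: SD; last exact: S0.
by apply/proj_eqP; rewrite reprK.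
Qed.

Lemma projD x y : proj (x + y) = proj x + proj y.
Proof. exact: raddfD. Qed.

Lemma quotient_scalerA a b v :
  quotient_scale a (quotient_scale b v) = quotient_scale (a * b) v.
Proof.
by elim/quotW: v => v; rewrite (quotient_scaleE b) !quotient_scaleE scalerA.
Qed.

Lemma quotient_scale1r : left_id 1 quotient_scale.
Proof. by elim/quotW => v; rewrite quotient_scaleE scale1r. Qed.

Lemma quotient_scalerDr : right_distributive quotient_scale +%R.
Proof.
move=> a; elim/quotW => v; elim/quotW => w.
by rewrite -projD !quotient_scaleE scalerDr projD.
Qed.

Lemma quotient_scalerDl v : {morph quotient_scale^~ v : a b / a + b}.
Proof.
by move=> a b; elim/quotW: v => v; rewrite !quotient_scaleE scalerDl projD.
Qed.

HB.instance Definition _ := GRing.Zmodule_isLmodule.Build A quotient_module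
  quotient_scalerA quotient_scale1r quotient_scalerDr quotient_scalerDl.

Lemma submodule_exists : exists (K : lmodType A) (i : {linear K -> V}),
  injective i /\ forall x, S x <-> exists y, i y = x.
Proof.
exists submodule, (mk_linear (f := submodule_val) (fun _ _ _ => erefl)).
split=> [x y /val_inj//|x]; split=> [Sx|[y <-]].
  by exists (Submodule (introT (asboolP _) Sx)).
exact/asboolP/submodule_valP.
Qed.

Lemma quotient_exists : exists (Q : lmodType A) (p : {linear V -> Q}),
  (forall y, exists x, p x = y) /\ forall x, p x = 0 <-> S x.
Proof.
pose p x : quotient_module := proj x.
have lp : linear p by move=> a x y; rewrite /p projD -quotient_scaleE.
exists quotient_module, (mk_linear lp); split=> [y|x] /=.
  by exists (repr y); exact: reprK.
have -> : 0 = p 0 by rewrite /p raddf0.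
by rewrite /p proj_eqP subr0.
Qed.

End SubQuotient.
End LinearMaps.


(** * Etale modules and their left inverses *)

(** Normal form for words in a group: products associated to the left, with the
    cancellations of adjacent inverse letters carried out. *)
Ltac group_normalize :=
  rewrite ?(invgM, invgK, invg1, mulgA, mulgK, mulgVK, mulgV, mulVg, mul1g,
    mulg1).
Ltac group_eq := group_normalize; by [].

Section EtaleModules.
Local Open Scope group_scope.
Variables (A : comPzRingType) (P : topGroupType) (L N0 : set P).

Lemma conjsetE (t x : P) (H : set P) : conjset t H x = H (t^-1 * x * t).
Proof.
apply/propext; split=> [[y Hy <-]|h]; first by group_normalize.
by exists (t^-1 * x * t) => //; group_normalize.
Qed.

Lemma conjsetMl (t u : P) (x : P) (H : set P) :
  conjset t (conjset u H) x = conjset (t * u) H x.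
Proof. by rewrite !conjsetE; group_normalize. Qed.

Hypotheses (gL : subgroup L) (gN0 : subgroup N0).

Lemma N01 : N0 1. Proof. by case: gN0. Qed.
Lemma N0M u v : N0 u -> N0 v -> N0 (u * v). Proof. by case: gN0 => _ + _; exact. Qed.
Lemma N0V u : N0 u -> N0 u^-1. Proof. by case: gN0 => _ _; exact. Qed.

Lemma Lplus1 : Lplus L N0 1.
Proof. by split; [case: gL|move=> x; rewrite conjsetE; group_normalize]. Qed.

Lemma LplusM t t' : Lplus L N0 t -> Lplus L N0 t' -> Lplus L N0 (t * t').
Proof.
move=> [Lt st] [Lt' st']; split; first by case: gL => _ + _; exact.
by move=> x; rewrite -conjsetMl => -[y /st' ? <-]; apply: st; exists y.
Qed.

Lemma Lplus_conj t u : Lplus L N0 t -> N0 u -> N0 (t * u * t^-1).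
Proof. by case=> _ st ?; apply: st; exists u. Qed.

Lemma Pplus_mul u t : N0 u -> Lplus L N0 t -> Pplus L N0 (u * t).
Proof. by move=> ? ?; exists u, t. Qed.

Lemma N0_Pplus u : N0 u -> Pplus L N0 u.
Proof. by move=> ?; rewrite -[u]mulg1; apply: Pplus_mul => //; exact: Lplus1. Qed.

Lemma Lplus_Pplus t : Lplus L N0 t -> Pplus L N0 t.
Proof. by move=> ?; rewrite -[t]mul1g; apply: Pplus_mul => //; exact: N01. Qed.

Lemma PplusM b c : Pplus L N0 b -> Pplus L N0 c -> Pplus L N0 (b * c).
Proof.
move=> [u [t [hu ht ->]]] [v [t' [hv ht' ->]]].
exists (u * (t * v * t^-1)), (t * t'); split; last by group_eq.
- by apply: N0M => //; exact: Lplus_conj.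
- exact: LplusM.
Qed.

Hint Resolve N01 N0M N0V Lplus1 LplusM Lplus_conj Pplus_mul N0_Pplus
  Lplus_Pplus PplusM : core.

(** A retraction of [pact M t] that vanishes on the other translates of its
    image; these are the properties that define [psi]. *)
Definition is_psi (M : pmodule A L N0) (t : P) (p : M -> M) : Prop :=
  (forall m, p (pact M t m) = m) /\
  (forall u m, N0 u -> ~ conjset t N0 u ->
     p (pact M u (pact M t m)) = 0%R).

Definition is_resolution (M : pmodule A L N0) (t : P) (p : M -> M) (J : seq P) :
    Prop :=
  forall m, m = (\sum_(u <- J) pact M (u * t)%g (p (pact M u^-1%g m)))%R.

Lemma pact_mulVK (M : pmodule A L N0) u m :
  N0 u -> pact M u (pact M u^-1%g m) = m.
Proof. by move=> hu; rewrite -pactM ?mulgV ?pact1; auto. Qed.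

Lemma pact_mulKV (M : pmodule A L N0) u m :
  N0 u -> pact M u^-1 (pact M u m) = m.
Proof. by move=> hu; rewrite -pactM ?mulVg ?pact1; auto. Qed.

(** If [u^-1 * w] lies in [t N0 t^-1], then [u^-1 * w * t = t * n] with [n] in
    [N0], and [p] undoes the action of [t]; otherwise the vanishing clause of
    [is_psi] applies. *)
Lemma is_psi_translate (M : pmodule A L N0) t p u w m :
  is_psi t p -> Lplus L N0 t -> N0 u -> N0 w ->
  p (pact M u^-1 (pact M (w * t) m)) =
  if `[< conjset t N0 (u^-1 * w) >] then
    pact M (t^-1 * (u^-1 * w) * t) m else 0%R.
Proof.
move=> [p1 p2] ht hu hw; case: asboolP => [|h]; rewrite -pactM; auto.
  rewrite conjsetE => h.
  rewrite -[RHS]p1 -pactM; auto.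
  by congr (p (pact M _ m)); group_eq.
rewrite mulgA pactM; auto.
Qed.

(** Used for sums in which only the coset of [w] contributes. *)
Lemma coset_representatives_sum (J : seq P) t w (V : zmodType) (F : P -> V) :
  coset_representatives N0 t J -> N0 w -> 
  (forall u, u \in J -> ~ conjset t N0 (u^-1 * w) -> F u = 0%R) ->
  exists2 u, u \in J /\ conjset t N0 (u^-1 * w) & (\sum_(u <- J) F u)%R = F u.
Proof.
move=> [uJ J0 JP] hw F0; have [u [[uin hu] uu]] := JP _ hw.
exists u => //; rewrite (bigD1_seq u) //= big1_seq ?GRing.addr0 //.
move=> v /andP[vu vin]; apply: F0 => // hv.
by case/eqP: vu; rewrite (uu v).
Qed.

(** By linearity it suffices to treat [m] of the form [pact M (w * t) m'], and then
    only the representative of the coset of [w] contributes to the sum. In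
    particular the spanning family need not be indexed by [J]. *)
Lemma resolutionP (M : pmodule A L N0) t (p : {linear M -> M}) J :
  Lplus L N0 t -> is_psi t p -> coset_representatives N0 t J ->
  (forall m, exists (I : seq P) (c : P -> M), (forall u, u \in I -> N0 u) /\
     m = (\sum_(u <- I) pact M (u * t)%g (c u))%R) ->
  is_resolution t p J.
Proof.
move=> ht pp JP span m; have [I [c [I0 ->]]] := span m.
under [RHS]eq_bigr do rewrite !linear_sum.
rewrite exchange_big /=; apply: eq_big_seq => w win.
have hw := I0 _ win; case: (JP) => _ J0 _.
have [|u [uin hu] ->] := coset_representatives_sum
  (F := fun u => pact M (u * t) (p (pact M u^-1 (pact M (w * t) (c w))))) JP hw.
  move=> u uin hu; rewrite is_psi_translate //; last exact: J0.
  by case: asboolP => // _; rewrite linear0.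
rewrite is_psi_translate //; last exact: J0.
case: asboolP => // _; move: (hu); rewrite conjsetE => h.
by rewrite -pactM; auto; congr (pact M _ _); group_eq.
Qed.

(** The resolution by [p] gives the decomposition of [M], and applying
    [p \o pact M w^-1] to a relation isolates its component at [w]. *)
Lemma etaleI (M : pmodule A L N0) :
  (forall t, Lplus L N0 t -> exists (p : {linear M -> M}) (J : seq P),
     [/\ is_psi t p, coset_representatives N0 t J & is_resolution t p J]) ->
  etale M.
Proof.
move=> H t ht; have [p [J [pp JP res]]] := H t ht.
split; first exact: (can_inj pp.1).
exists J => //; case: (JP) => uJ J0 _; split=> [m|c cP c0 w win].
  exists (fun u => pact M (u * t) (p (pact M u^-1%g m))) => // u uin.
  by exists (p (pact M u^-1%g m)) => //; rewrite pactM; auto.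
have cP' u : exists m, u \in J -> c u = pact M (u * t) m.
  have [uin|_] := boolP (u \in J); last by exists 0%R.
  by have [m _ <-] := cP _ uin; exists m; rewrite pactM; auto.
have [d dP] := choice cP'.
suff d0 : d w = 0%R by rewrite dP // d0 linear0.
have := congr1 (fun m => p (pact M w^-1 m)) c0.
rewrite !linear0 !linear_sum /= (bigD1_seq w) //= big1_seq ?GRing.addr0.
  rewrite dP // is_psi_translate //; auto.
  case: asboolP => [_|]; first by rewrite mulVg mulg1 mulVg pact1.
  by case; rewrite conjsetE; group_normalize.
move=> u /andP[uw uin]; rewrite dP // is_psi_translate //; auto.
case: asboolP => // h; case/eqP: uw; case: JP => _ _ JP.
have [v [_ vv]] := JP _ (J0 _ uin).
have <- : v = u by apply: vv; split; rewrite // conjsetE; group_normalize.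
by apply: vv; split.
Qed.

(** The retraction is read off the decomposition: it extracts the component of
    [m] at the representative [u0] of the trivial coset. *)
Lemma etale_psi (M : pmodule A L N0) : etale M -> forall t, Lplus L N0 t ->
  is_psi t (psi M t) /\ forall J, coset_representatives N0 t J ->
    is_resolution t (psi M t) J.
Proof.
move=> eM t ht; have [injt [I IP [dec uni]]] := eM t ht.
have [uI I0 IU] := IP.
have span m : exists c : P -> M, m = (\sum_(u <- I) pact M (u * t)%g (c u))%R.
  have [c cP ->] := dec m.
  have cP' u : exists m, u \in I -> c u = pact M (u * t) m.
    have [uin|_] := boolP (u \in I); last by exists 0%R.
    by have [m' _ <-] := cP _ uin; exists m'; rewrite pactM; auto.
  have [d dP] := choice cP'; exists d.
  by rewrite big_seq [RHS]big_seq; apply: eq_bigr => u /dP.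
have [e eP] := choice span.
have e_uniq c m : m = (\sum_(u <- I) pact M (u * t)%g (c u))%R ->
    forall u, u \in I -> c u = e m u.
  move=> cE u uin; apply: injt.
  suff : (pact M (u * t)%g (c u - e m u)%R) = 0%R.
    rewrite pactM; auto => /(congr1 (pact M u^-1)).
    rewrite linear0 pact_mulKV; auto; rewrite linearB => /eqP.
    by rewrite GRing.subr_eq0 => /eqP.
  apply: (uni (fun u => pact M (u * t)%g (c u - e m u)%R)) uin.
    by move=> v vin; exists (c v - e m v)%R => //; rewrite -pactM; auto.
  under eq_bigr do rewrite linearB.
  by rewrite GRing.sumrB -cE -eP GRing.subrr.
(* [u0] need not be [1], hence the correction by [t^-1 * u0 * t] in [q]. *)
have [u0 [[u0in h0] u0u]] := IU 1 N01.
have hk : N0 (t^-1 * u0 * t).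
  by move: h0; rewrite mulg1 conjsetE => /N0V; group_normalize.
pose q m := pact M (t^-1 * u0 * t) (e m u0).
have lq : linear q.
  move=> a x y; rewrite /q -linearP; congr (pact M _ _).
  symmetry; apply: (e_uniq (fun u => a *: e x u + e y u)%R) => //.
  under eq_bigr do rewrite linearP.
  by rewrite big_split /= -GRing.scaler_sumr -!eP.
have q_single v m w : v \in I -> N0 w -> conjset t N0 (v^-1 * w) ->
    q (pact M (w * t) m) =
    if u0 == v then pact M (t^-1 * w * t) m else 0%R.
  move=> vin hw hvw; rewrite /q.
  rewrite -(e_uniq (fun u => if u == v then pact M (t^-1 * (v^-1 * w) * t) m
                            else 0%R)) //.
    case: eqP => [E|]; last by rewrite linear0.
    rewrite -E -pactM; auto; first by congr (pact M _ _); group_eq.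
    by apply: N0_Pplus; move: hvw; rewrite -E conjsetE.
  rewrite (bigD1_seq v) //= eqxx big1_seq => [|u /andP[/negPf->]]; last first.
    by rewrite linear0.
  rewrite GRing.addr0 -pactM; auto; first by congr (pact M _ _); group_eq.
  by apply: N0_Pplus; move: hvw; rewrite conjsetE.
have qP : is_psi t (mk_linear lq).
  split=> [m|w m hw nw] /=.
    rewrite -[X in pact M X _]mul1g (q_single u0) // eqxx.
    by rewrite mulg1 mulVg pact1.
  rewrite -pactM; auto; have [v [[vin hv] _]] := IU _ hw.
  rewrite (q_single v) //; case: eqP => // E; case: nw.
  move: hv h0; rewrite -E !conjsetE => hv h0.
  have := N0M (N0V h0) hv; by group_normalize.
have psiP : is_psi t (psi M t).
  by rewrite /psi; case: xgetP => [p -> //|/(_ (mk_linear lq))].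
split=> // J JP; apply: resolutionP => // m.
by exists I, (e m); split.
Qed.

Lemma etale_reps (M : pmodule A L N0) t : etale M -> Lplus L N0 t ->
  exists J, coset_representatives N0 t J.
Proof. by move=> eM ht; have [_ [J JP _]] := eM t ht; exists J. Qed.

Lemma is_psi_uniq (M : pmodule A L N0) (p : {linear M -> M}) t :
  etale M -> Lplus L N0 t -> is_psi t p -> p =1 psi M t.
Proof.
move=> eM ht pp m; have [qq res] := etale_psi eM ht.
have [J JP] := etale_reps eM ht; case: (JP) => _ J0 _.
rewrite {1}[m](res _ JP) [m in RHS](res _ JP) !linear_sum /=.
apply: eq_big_seq => u uin; have hu := J0 _ uin.
have := is_psi_translate (psi M t (pact M u^-1%g m)) pp ht N01 hu.
have := is_psi_translate (psi M t (pact M u^-1%g m)) qq ht N01 hu.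
by rewrite invg1 !pact1 => -> ->.
Qed.

(** The maps [psi] are determined by the action, so morphisms respect them. *)
Lemma ethom_psi (M M' : etmod A L N0) (f : ethom M M') t m :
  Lplus L N0 t -> f (psi M t m) = psi M' t (f m).
Proof.
move=> ht; have [pp res] := etale_psi (etmodP M) ht.
have [pp' _] := etale_psi (etmodP M') ht.
have [J JP] := etale_reps (etmodP M) ht; case: (JP) => _ J0 _.
rewrite [m](res _ JP) !linear_sum /=.
apply: eq_big_seq => u uin; have hu := J0 _ uin.
have := is_psi_translate (psi M t (pact M u^-1%g m)) pp ht N01 hu.
have := is_psi_translate (f (psi M t (pact M u^-1%g m))) pp' ht N01 hu.
rewrite invg1 !pact1 ethomP; auto => -> ->.
case: asboolP => [|_]; last by rewrite linear0.
by rewrite conjsetE mul1g => h; rewrite ethomP; auto.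
Qed.

End EtaleModules.


(** * The category of etale modules is abelian *)

Section AbelianEtale.
Local Open Scope group_scope.
Variables (A : comPzRingType) (P : topGroupType) (L N0 : set P).
Hypotheses (gL : subgroup L) (gN0 : subgroup N0).
Hypothesis repsP : forall t, Lplus L N0 t ->
  exists J, coset_representatives N0 t J.

Local Notation Mod := (etmod A L N0).
Local Notation Plus := (Pplus L N0).

(** A submodule of [M] is a subobject, and defines a quotient, when it is
    stable under the action and under the maps [psi]. *)
Definition stable (M : Mod) (S : M -> Prop) : Prop :=
  (forall b m, Plus b -> S m -> S (pact M b m)) /\
  (forall t m, Lplus L N0 t -> S m -> S (psi M t m)).

Lemma subobject (M : Mod) (S : M -> Prop) : submodule_property S -> stable S ->
  exists (E : Mod) (j : ethom E M),
    injective j /\ forall m, S m <-> exists e, j e = m.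
Proof.
move=> /submodule_exists[K [i [inji iS]]] [Sact Spsi].
have [a aP] : exists a : P -> {linear K -> K}, forall b,
    (Plus b -> forall k, i (a b k) = pact M b (i k)) /\
    (~ Plus b -> forall k, a b k = 0%R).
  suff /choice[a aP] : forall b : P, exists ab : {linear K -> K},
      (Plus b -> forall k, i (ab k) = pact M b (i k)) /\
      (~ Plus b -> forall k, ab k = 0%R) by exists a.
  move=> b.
  have [hb|nb] := pselect (Plus b); last by exists \0.
  have [|g gP] := lift_linear (f := pact M b \o i) inji; last by exists g.
  by move=> x; apply/iS/Sact => //; apply/iS; exists x.
have aE b k : Plus b -> i (a b k) = pact M b (i k) by move=> /(aP b).1.
have a1 m : a 1 m = m.
  by apply: inji; rewrite aE ?pact1 //; apply: N0_Pplus => //; exact: N01.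
have aM b c m : Plus b -> Plus c -> a (b * c) m = a b (a c m).
  by move=> hb hc; apply: inji; rewrite !aE ?pactM //; exact: PplusM.
have aout b m : ~ Plus b -> a b m = 0%R by move=> /(aP b).2.
pose E0 := PModule a1 aM aout.
have eE : etale E0.
  apply: etaleI => // t ht.
  have [J JP] := repsP ht; have [[p1 p2] res] := etale_psi gL gN0 (etmodP M) ht.
  have tP := Lplus_Pplus gN0 ht.
  have [|p pP] := lift_linear (f := psi M t \o i) inji.
    by move=> x; apply/iS/Spsi => //; apply/iS; exists x.
  exists p, J; split=> //; first split.
  - by move=> m; apply: inji; rewrite pP /= aE // p1.
  - move=> u m hu nu; apply: inji; have uP := N0_Pplus gL hu.
    by rewrite pP /= !aE // p2 // linear0.
  - move=> m; apply: inji; rewrite linear_sum /= {1}[i m](res J) //.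
    apply: eq_big_seq => u uin; case: JP => _ /(_ _ uin) hu _.
    have uP := N0_Pplus gL hu; have uV := N0_Pplus gL (N0V gN0 hu).
    by rewrite aE ?pP /= ?aE //; exact: PplusM.
pose E := EtMod eE.
have jP b m : Plus b -> i (pact E b m) = pact M b (i m) by exact: aE.
by exists E, (@EtHom _ _ _ _ E M i jP).
Qed.

Lemma quotient_object (M : Mod) (S : M -> Prop) :
  submodule_property S -> stable S ->
  exists (E : Mod) (p : ethom M E),
    (forall e, exists m, p m = e) /\ forall m, p m = 0%R <-> S m.
Proof.
move=> /quotient_exists[K [i [surji iS]]] [Sact Spsi].
have [a aP] : exists a : P -> {linear K -> K}, forall b,
    (Plus b -> forall k, a b (i k) = i (pact M b k)) /\
    (~ Plus b -> forall k, a b k = 0%R).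
  suff /choice[a aP] : forall b : P, exists ab : {linear K -> K},
      (Plus b -> forall k, ab (i k) = i (pact M b k)) /\
      (~ Plus b -> forall k, ab k = 0%R) by exists a.
  move=> b.
  have [hb|nb] := pselect (Plus b); last by exists \0.
  have [|g gP] := factor_linear (f := i \o pact M b) surji; last by exists g.
  by move=> x /iS Sx; apply/iS/Sact.
have aE b k : Plus b -> a b (i k) = i (pact M b k) by move=> /(aP b).1.
have a1 m : a 1 m = m.
  case: (surji m) => {}m <-.
  by rewrite aE ?pact1 //; apply: N0_Pplus => //; exact: N01.
have aM b c m : Plus b -> Plus c -> a (b * c) m = a b (a c m).
  case: (surji m) => {}m <- hb hc.
  by rewrite !aE ?pactM //; exact: PplusM.
have aout b m : ~ Plus b -> a b m = 0%R by move=> /(aP b).2.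
pose E0 := PModule a1 aM aout.
have eE : etale E0.
  apply: etaleI => // t ht.
  have [J JP] := repsP ht; have [[p1 p2] res] := etale_psi gL gN0 (etmodP M) ht.
  have tP := Lplus_Pplus gN0 ht.
  have [|p pP] := factor_linear (f := i \o psi M t) surji.
    by move=> x /iS Sx; apply/iS/Spsi.
  exists p, J; split=> //; first split.
  - by move=> m; case: (surji m) => {}m <-; rewrite /= aE // pP /= p1.
  - move=> u m hu nu; case: (surji m) => {}m <-; have uP := N0_Pplus gL hu.
    by rewrite /= !aE // pP /= p2 // linear0.
  - move=> m; case: (surji m) => {}m <-; rewrite /= {1}[m](res J) // linear_sum.
    apply: eq_big_seq => u uin; case: JP => _ /(_ _ uin) hu _.
    have uP := N0_Pplus gL hu; have uV := N0_Pplus gL (N0V gN0 hu).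
    by rewrite /= aE // pP /= aE //; exact: PplusM.
pose E := EtMod eE.
have jP b m : Plus b -> i (pact M b m) = pact E b (i m) by move=> ?; rewrite -aE.
by exists E, (@EtHom _ _ _ _ M E i jP).
Qed.

Lemma ethom_lift (K M T : Mod) (j : ethom K M) (f : ethom T M) :
  injective j -> (forall x, exists y, j y = f x) ->
  exists! u : ethom T K, ethom_comp j u = f.
Proof.
move=> injj jf; have [g gP] := lift_linear injj jf.
have gact b m : Plus b -> g (pact T b m) = pact K b (g m).
  by move=> hb; apply: injj; rewrite gP !ethomP // gP.
exists (EtHom gact); split; first exact: ethom_eqP.
move=> h jh; apply: ethom_eqP => x; apply: injj => /=.
by rewrite gP -jh.
Qed.

Lemma ethom_factor (M Q T : Mod) (p : ethom M Q) (f : ethom M T) :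
  (forall y, exists x, p x = y) -> (forall x, p x = 0%R -> f x = 0%R) ->
  exists! u : ethom Q T, ethom_comp u p = f.
Proof.
move=> surjp pf; have [g gP] := factor_linear surjp pf.
have gact b m : Plus b -> g (pact Q b m) = pact T b (g m).
  by move=> hb; case: (surjp m) => {}m <-; rewrite -ethomP // !gP ethomP.
exists (EtHom gact); split; first exact: ethom_eqP.
move=> h hp; apply: ethom_eqP => y; case: (surjp y) => x <- /=.
by rewrite gP -hp.
Qed.

Lemma ethom_iso (M M' : Mod) (f : ethom M M') :
  bijective f -> @isomorphism (EtaleModules A L N0) M M' f.
Proof.
move=> /inverse_linear[g [fg gf]].
have gact b m : Plus b -> g (pact M' b m) = pact M b (g m).
  by move=> hb; apply: (can_inj fg); rewrite ethomP // !gf.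
by exists (EtHom gact); split; apply: ethom_eqP => x /=.
Qed.

Lemma ethom0_subproof (M M' : Mod) b m :
  Plus b -> (\0 : {linear M -> M'})%R (pact M b m) =
    pact M' b ((\0 : {linear M -> M'})%R m).
Proof. by rewrite /= linear0. Qed.

Definition ethom0 (M M' : Mod) : ethom M M' := EtHom (@ethom0_subproof M M').

(** The module of row vectors with no entries serves as the zero module. *)
Lemma zero_etmod_exists : exists Z : Mod, forall z : Z, z = 0%R.
Proof.
have z0 (x : 'rV[A]_0) : x = 0%R by exact: thinmx0.
have z1 (x : 'rV[A]_0) : (\0 : {linear 'rV[A]_0 -> 'rV[A]_0})%R x = x.
  by rewrite [RHS]z0.
pose E := PModule (L := L) (N0 := N0) (pact := fun=> \0) z1 
  (fun b c m _ _ => erefl) (fun b m _ => erefl).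
have eE : etale E.
  apply: etaleI => // t ht; have [J JP] := repsP ht; exists \0, J.
  split=> //; last by move=> m; rewrite (z0 m); exact/esym/z0.
by exists (EtMod eE).
Qed.

Lemma zero_objectE (Z : Mod) :
  @zero_object (EtaleModules A L N0) Z <-> forall z : Z, z = 0%R.
Proof.
split=> [zZ z|z0 M].
  have [_ [f [_ uf]]] := zZ Z.
  have := uf (ethom_id Z) I; rewrite (uf (ethom0 Z Z)) //.
  move=> /(congr1 (fun g : ethom Z Z => g z)).
  by move=> /= <-.
split; exists (ethom0 _ _); split=> // f _; apply: ethom_eqP => x /=.
  by rewrite [RHS]z0.
by rewrite (z0 x) linear0.
Qed.

Lemma zero_morphismE (M M' : Mod) (f : ethom M M') :
  @zero_morphism (EtaleModules A L N0) M M' f <-> forall x, f x = 0%R.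
Proof.
split=> [[Z /zero_objectE z0 [g [h ->]]] x /=|f0].
  by rewrite (z0 (h x)) linear0.
have [Z z0] := zero_etmod_exists.
exists Z; first exact/zero_objectE.
by exists (ethom0 Z M'), (ethom0 M Z); apply: ethom_eqP => x; rewrite f0.
Qed.

Lemma ker_submodule (M M' : Mod) (f : ethom M M') :
  submodule_property (fun x => f x = 0%R).
Proof.
split=> [|a x y fx fy]; first by rewrite linear0.
by rewrite linearP fx fy GRing.scaler0 GRing.addr0.
Qed.

Lemma ker_stable (M M' : Mod) (f : ethom M M') : stable (fun x => f x = 0%R).
Proof.
split=> [b m hb fm|t m ht fm]; first by rewrite ethomP // fm linear0.
by rewrite (ethom_psi gL gN0) // fm linear0.
Qed.

Lemma range_submodule (M M' : Mod) (f : ethom M M') :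
  submodule_property (fun y => exists x, f x = y).
Proof.
split=> [|a _ _ [x <-] [y <-]]; first by exists 0%R; rewrite linear0.
by exists (a *: x + y)%R; rewrite linearP.
Qed.

Lemma range_stable (M M' : Mod) (f : ethom M M') :
  stable (fun y => exists x, f x = y).
Proof.
split=> [b _ hb [x <-]|t _ ht [x <-]]; first by exists (pact M b x); rewrite ethomP.
by exists (psi M t x); rewrite (ethom_psi gL gN0).
Qed.

Lemma etmod_kernel (M M' : Mod) (f : ethom M M') :
  exists (K : Mod) (k : ethom K M),
    injective k /\ forall m, f m = 0%R <-> exists e, k e = m.
Proof. exact: (subobject (ker_submodule f) (ker_stable f)). Qed.

Lemma etmod_cokernel (M M' : Mod) (f : ethom M M') :
  exists (Q : Mod) (q : ethom M' Q),
    (forall e, exists m, q m = e) /\ forall m, q m = 0%R <-> exists x, f x = m.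
Proof. exact: (quotient_object (range_submodule f) (range_stable f)). Qed.

(** The inclusion of the kernel and the zero map have the same composite with
    [f], hence are equal. *)
Lemma monic_injective (M M' : Mod) (f : ethom M M') :
  @monic (EtaleModules A L N0) M M' f -> injective f.
Proof.
move=> mf; have [K [k [_ kP]]] := etmod_kernel f.
have f0 x : f x = 0%R -> x = 0%R.
  case/kP => e <-.
  have /(congr1 (fun g : ethom K M => g e)) // : k = ethom0 K M.
  apply: mf; apply: ethom_eqP => y /=; rewrite linear0.
  by apply/kP; exists y.
move=> x y fxy; apply/eqP; rewrite -GRing.subr_eq0; apply/eqP/f0.
by rewrite linearB fxy GRing.subrr.
Qed.

(** Dually, the projection to the cokernel is zero. *)
Lemma epic_surjective (M M' : Mod) (f : ethom M M') :
  @epic (EtaleModules A L N0) M M' f -> forall y, exists x, f x = y.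
Proof.
move=> ef y; have [Q [q [_ qP]]] := etmod_cokernel f.
apply/qP; have -> // : q = ethom0 M' Q.
apply: ef; apply: ethom_eqP => x /=.
by apply/qP; exists x.
Qed.

Lemma biproduct_exists (M M' : Mod) :
  exists (B : Mod) (p : ethom B M) (q : ethom B M') (i : ethom M B)
         (j : ethom M' B),
  [/\ forall x, p (i x) = x, forall y, q (j y) = y, forall x, q (i x) = 0%R,
      forall y, p (j y) = 0%R & forall z, z = (i (p z) + j (q z))%R].
Proof.
pose B0 : lmodType A := (M * M')%type.
pose pr1 : {linear B0 -> M} := mk_linear (fun _ _ _ => erefl) (f := fst).
pose pr2 : {linear B0 -> M'} := mk_linear (fun _ _ _ => erefl) (f := snd).
pose mkp (f : {linear M -> M}) (g : {linear M' -> M'}) (z : B0) : B0 :=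
  (f z.1, g z.2).
have lp f g : linear (mkp f g) by move=> a x y; rewrite /mkp !linearP.
pose a b := mk_linear (lp (pact M b) (pact M' b)).
have a1 m : a 1 m = m by case: m => x y; rewrite /= /mkp /= !pact1.
have aM b c m : Plus b -> Plus c -> a (b * c) m = a b (a c m).
  by move=> hb hc; rewrite /= /mkp /= !pactM.
have aout b m : ~ Plus b -> a b m = 0%R by move=> nb; rewrite /= /mkp !pact_out.
pose E0 := PModule a1 aM aout.
have eE : etale E0.
  apply: etaleI => // t ht; have [J JP] := repsP ht.
  have [[p1 p2] res] := etale_psi gL gN0 (etmodP M) ht.
  have [[q1 q2] res'] := etale_psi gL gN0 (etmodP M') ht.
  exists (mk_linear (lp (psi M t) (psi M' t))), J; split=> //; first split.
  - by case=> x y; rewrite /= /mkp /= p1 q1.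
  - by move=> u [x y] hu nu; rewrite /= /mkp /= p2 ?q2.
  - move=> z; rewrite [LHS]surjective_pairing [RHS]surjective_pairing.
    congr pair.
      by rewrite (linear_sum pr1) /=; exact: res.
    by rewrite (linear_sum pr2) /=; exact: res'.
pose E : Mod := EtMod eE.
have li1 : linear (fun x : M => (x, 0%R) : B0).
  by move=> c x y; congr pair; rewrite /= GRing.scaler0 GRing.addr0.
have li2 : linear (fun y : M' => (0%R, y) : B0).
  by move=> c x y; congr pair; rewrite /= GRing.scaler0 GRing.addr0.
have pP b m : Plus b -> pr1 (pact E b m) = pact M b (pr1 m) by [].
have qP b m : Plus b -> pr2 (pact E b m) = pact M' b (pr2 m) by [].
have iP b m : Plus b -> mk_linear li1 (pact M b m) = pact E b (mk_linear li1 m).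
  by rewrite /= /mkp /= linear0.
have jP b m : Plus b -> mk_linear li2 (pact M' b m) = pact E b (mk_linear li2 m).
  by rewrite /= /mkp /= linear0.
exists E, (@EtHom _ _ _ _ E M pr1 pP), (@EtHom _ _ _ _ E M' pr2 qP),
  (@EtHom _ _ _ _ M E _ iP), (@EtHom _ _ _ _ M' E _ jP); split=> //= -[x y] /=.
by congr pair; rewrite /= ?GRing.addr0 ?GRing.add0r.
Qed.

Lemma etale_abelian : abelian (EtaleModules A L N0).
Proof.
split; [|split; [|split; [|split; [|split; [|split]]]]].
- by have [Z zZ] := zero_etmod_exists; exists Z; apply/zero_objectE.
- move=> M M'; have [B [p [q [i [j [pi qj qi pj dec]]]]]] := biproduct_exists M M'.
  exists B, p, q => T f g.
  pose h x : B := (i (f x) + j (g x))%R.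
  have lh : linear h.
    by move=> a x y; rewrite /h !linearP GRing.scalerDr GRing.addrACA.
  have hP b m : Plus b -> mk_linear lh (pact T b m) = pact B b (mk_linear lh m).
    by move=> hb; rewrite /= /h !ethomP // -linearD.
  exists (EtHom hP : hom (c := EtaleModules A L N0) T B); split.
    split; apply: ethom_eqP => x; rewrite /= /h linearD /=.
      by rewrite pi pj GRing.addr0.
    by rewrite qi qj GRing.add0r.
  move=> u [pu qu]; apply: ethom_eqP => x /=.
  by rewrite /h [RHS]dec -pu -qu.
- move=> M M'; have [B [p [q [i [j [pi qj qi pj dec]]]]]] := biproduct_exists M M'.
  exists B, i, j => T f g.
  pose h z : T := (f (p z) + g (q z))%R.
  have lh : linear h.
    by move=> a x y; rewrite /h !linearP GRing.scalerDr GRing.addrACA.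
  have hP b m : Plus b -> mk_linear lh (pact B b m) = pact T b (mk_linear lh m).
    by move=> hb; rewrite /= /h !ethomP // -linearD.
  exists (EtHom hP : hom (c := EtaleModules A L N0) B T); split.
    split; apply: ethom_eqP => x; rewrite /= /h.
      by rewrite pi qi linear0 GRing.addr0.
    by rewrite qj pj linear0 GRing.add0r.
  move=> u [pu qu]; apply: ethom_eqP => x /=.
  by rewrite /h [in RHS](dec x) linearD -pu -qu.
- move=> M M' f; have [K [k [injk kP]]] := etmod_kernel f.
  exists K, k; split; first by apply/zero_morphismE => x; apply/kP; exists x.
  move=> T g /zero_morphismE fg; apply: ethom_lift => // x.
  exact/kP/fg.
- move=> M M' f; have [Q [q [surjq qP]]] := etmod_cokernel f.
  exists Q, q; split; first by apply/zero_morphismE => x; apply/qP; exists x.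
  move=> T g /zero_morphismE gf; apply: ethom_factor => // y.
  by case/qP => x <-; exact: gf.
- move=> M M' f /monic_injective injf; have [Q [q [surjq qP]]] := etmod_cokernel f.
  exists Q, q; split; first by apply/zero_morphismE => x; apply/qP; exists x.
  move=> T g /zero_morphismE qg; apply: ethom_lift => // x.
  exact/qP/qg.
- move=> M M' f /epic_surjective surjf; have [K [k [injk kP]]] := etmod_kernel f.
  exists K, k; split; first by apply/zero_morphismE => x; apply/kP; exists x.
  move=> T g /zero_morphismE gk; apply: ethom_factor => // y.
  by case/kP => x <-; exact: gk.
Qed.

End AbelianEtale.


(** * Balls in the group N *)

Section Balls.
Local Open Scope group_scope.
Variables (P : topGroupType) (N L : set P) (N0 : opens N) (s : P).
Hypotheses (locP : locally_profinite P) (PNL : semidirect_product N L)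
  (N0prof : profinite_subgroup N0) (hs : contracting N L N0 s).

Local Notation N0s := (opens_set N0).
Local Notation lpart := (lpart N L).
Local Notation dot := (dot N L).
Local Notation Lplus := (Lplus L N0).
Local Notation Pplus := (Pplus L N0).

Lemma gL : subgroup L. Proof. by case: PNL => _ []. Qed.
Lemma gN : subgroup N. Proof. by case: PNL => -[]. Qed.
Lemma gN0 : subgroup N0. Proof. by case: N0prof. Qed.
Lemma N1 : N 1. Proof. by case: gN. Qed.
Lemma NM x y : N x -> N y -> N (x * y). Proof. by case: gN => _ + _; exact. Qed.
Lemma NV x : N x -> N x^-1. Proof. by case: gN => _ _; exact. Qed.
Lemma L1 : L 1. Proof. by case: gL. Qed.
Lemma LM x y : L x -> L y -> L (x * y). Proof. by case: gL => _ + _; exact. Qed.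
Lemma LV x : L x -> L x^-1. Proof. by case: gL => _ _; exact. Qed.

Lemma opens_subset (U : opens N) : U `<=` N.
Proof. by case: U => U [O _ /= ->] x []. Qed.

Lemma NJ b x : N x -> N (b * x * b^-1).
Proof. by move=> Nx; case: PNL => _ _ H _ _; apply: (H b); exists x. Qed.

Lemma lpartP b : L (lpart b) /\ N (b * (lpart b)^-1).
Proof.
have [_ _ _ _ dec] := PNL; have [n [t [Nn Lt bE]]] := dec b.
apply: (@xgetPex _ _ [set t | L t /\ N (b * t^-1)]); exists t; split=> //.
by rewrite bE; group_normalize.
Qed.

Lemma lpartE n t : N n -> L t -> lpart (n * t) = t.
Proof.
move=> Nn Lt; have [Ll Nl] := lpartP (n * t).
have [_ _ _ NL _] := PNL.
have : (N `&` L) (t * (lpart (n * t))^-1).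
  split; last by apply: LM => //; exact: LV.
  by have := NM (NV Nn) Nl; group_normalize.
rewrite NL /= => /(congr1 (fun g => g^-1)); rewrite invgM invgK invg1.
by move/divg1_eq.
Qed.

Lemma lpartM b c : lpart (b * c) = lpart b * lpart c.
Proof.
have [Lb Nb] := lpartP b; have [Lc Nc] := lpartP c.
rewrite -(@lpartE
  (b * (lpart b)^-1 * (lpart b * (c * (lpart c)^-1) * (lpart b)^-1))
  (lpart b * lpart c)); last exact: LM; last by apply: NM => //; exact: NJ.
by congr (Defs.lpart N L _); group_eq.
Qed.

Lemma lpart1 : lpart 1 = 1.
Proof. by rewrite -[X in lpart X]mulg1 lpartE //; [exact: N1|exact: L1]. Qed.

Lemma lpart_L t : L t -> lpart t = t.
Proof. by move=> Lt; rewrite -[X in lpart X]mul1g lpartE //; exact: N1. Qed.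

Lemma lpart_N n : N n -> lpart n = 1.
Proof. by move=> Nn; rewrite -[X in lpart X]mulg1 lpartE //; exact: L1. Qed.

Lemma dotM b c x : dot (b * c) x = dot b (dot c x).
Proof. by rewrite /Defs.dot lpartM; group_eq. Qed.

Lemma dot1 x : dot 1 x = x.
Proof. by rewrite /Defs.dot lpart1; group_eq. Qed.

Lemma dotK b x : dot b^-1 (dot b x) = x.
Proof. by rewrite -dotM mulVg dot1. Qed.

Lemma dotVK b x : dot b (dot b^-1 x) = x.
Proof. by rewrite -dotM mulgV dot1. Qed.

Lemma dotN b x : N x -> N (dot b x).
Proof.
move=> Nx; rewrite /Defs.dot.
have -> : b * x * (lpart b)^-1 = b * x * b^-1 * (b * (lpart b)^-1) by group_eq.
by apply: NM; [exact: NJ|case: (lpartP b)].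
Qed.

Lemma dot_lmul n x : N n -> dot n x = n * x.
Proof. by move=> Nn; rewrite /Defs.dot lpart_N //; group_eq. Qed.

Lemma dot_L t x : L t -> dot t x = t * x * t^-1.
Proof. by move=> Lt; rewrite /Defs.dot lpart_L. Qed.

Lemma continuous_mull (a : P) : continuous (fun x : P => a * x).
Proof.
move=> x; apply: (@continuous_comp _ _ _ (fun x : P => (a, x))
  (fun z : P * P => z.1 * z.2)); last exact: mulg_continuous.
by apply: cvg_pair; [exact: cvg_cst|exact: cvg_id].
Qed.

Lemma continuous_mulr (a : P) : continuous (fun x : P => x * a).
Proof.
move=> x; apply: (@continuous_comp _ _ _ (fun x : P => (x, a))
  (fun z : P * P => z.1 * z.2)); last exact: mulg_continuous.
by apply: cvg_pair; [exact: cvg_id|exact: cvg_cst].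
Qed.

Lemma continuous_dot b : continuous (dot b).
Proof.
move=> x; apply: (@continuous_comp _ _ _ (fun x : P => b * x)
  (fun y : P => y * (lpart b)^-1)); first exact: continuous_mull.
exact: continuous_mulr.
Qed.

Lemma image_dotE b (U : set P) x : (dot b @` U) x <-> U (dot b^-1 x).
Proof.
split=> [[y Uy <-]|h]; first by rewrite dotK.
by exists (dot b^-1 x); rewrite ?dotVK.
Qed.

Lemma image_dotM b c (U : set P) : dot (b * c) @` U = dot b @` (dot c @` U).
Proof.
by apply/seteqP; split=> x; rewrite !image_dotE invgM dotM.
Qed.

Lemma image_dot1 (U : set P) : dot 1 @` U = U.
Proof. by apply/seteqP; split=> x; rewrite image_dotE invg1 dot1. Qed.

Lemma image_dotK b (U : set P) : dot b^-1 @` (dot b @` U) = U.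
Proof. by rewrite -image_dotM mulVg image_dot1. Qed.

Lemma image_dotVK b (U : set P) : dot b @` (dot b^-1 @` U) = U.
Proof. by rewrite -image_dotM mulgV image_dot1. Qed.

Lemma image_dotS b (U V : set P) : U `<=` V -> dot b @` U `<=` dot b @` V.
Proof. by move=> UV x; rewrite !image_dotE; exact: UV. Qed.

Lemma open_in_image b (U : set P) : open_in N U -> open_in N (dot b @` U).
Proof.
case=> O oO ->; exists (dot b^-1 @^-1` O).
  by apply: open_comp => // x _; exact: continuous_dot.
apply/seteqP; split=> x; rewrite image_dotE /=.
  by move=> [Nx Ox]; split=> //; rewrite -[x](dotVK b); exact: dotN.
by move=> [Nx Ox]; split=> //; exact: dotN.
Qed.

Definition image_opens b (U : opens N) : opens N :=
  Opens (open_in_image b (opens_setP U)).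

(** The translates of [N0] under [P]. Elements of [L] change the shape of the
    ball, elements of [N] its position, and [b] is not determined by its ball. *)
Definition ball b : set P := dot b @` N0.

Definition ball_opens b : opens N := image_opens b N0.

Lemma ballP b x : ball b x <-> N0s (dot b^-1 x).
Proof. exact: image_dotE. Qed.

Lemma ball_image b c : dot b @` ball c = ball (b * c).
Proof. by rewrite /ball image_dotM. Qed.

Lemma ball1 : ball 1 = N0. Proof. exact: image_dot1. Qed.

(** The [N]-part of [b] is [dot b 1], so it lies in [N0] when the ball does; the
    [L]-part then maps [N0] into itself. *)
Lemma PplusP b : Pplus b <-> ball b `<=` N0.
Proof.
have g1 := N01 gN0; split.
  move=> [u [t [hu ht ->]]] x [y hy <-].
  rewrite dotM dot_lmul; last exact: opens_subset hu.
  by apply: (N0M gN0 hu); rewrite dot_L; [exact: Lplus_conj ht hy|case: ht].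
move=> h; have [Ll Nl] := lpartP b; exists (b * (lpart b)^-1), (lpart b).
have hu : N0s (b * (lpart b)^-1).
  by apply: h; exists 1 => //; rewrite /Defs.dot mulg1.
split=> //; last by group_eq.
split=> // x; rewrite conjsetE => hx.
have : N0s (dot b ((lpart b)^-1 * x * lpart b)).
  by apply: h; exists ((lpart b)^-1 * x * lpart b).
move/(N0M gN0 (N0V gN0 hu)); rewrite /Defs.dot.
by group_normalize.
Qed.

Lemma ball_subP b c : ball b `<=` ball c <-> Pplus (c^-1 * b).
Proof.
rewrite PplusP -ball_image; split=> [/(@image_dotS c^-1)|/(@image_dotS c)].
  by rewrite (ball_image _ c) mulVg ball1.
by rewrite -image_dotM mulgV image_dot1.
Qed.

Lemma ball_center b : ball b (dot b 1).
Proof. by exists 1 => //; exact: N01 gN0. Qed.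

Lemma ball_subset b : ball b `<=` N.
Proof. by move=> _ [x /opens_subset Nx <-]; exact: dotN. Qed.

Lemma compact_image b (K : set P) : compact K -> compact (dot b @` K).
Proof.
move=> cK; apply: continuous_compact => //.
by apply: continuous_subspaceT => x; exact: continuous_dot.
Qed.

Lemma compact_N0 : compact N0. Proof. by case: N0prof. Qed.

Lemma compact_ball b : compact (ball b).
Proof. exact/compact_image/compact_N0. Qed.

Lemma compact_closedP (K : set P) : compact K -> closed K.
Proof. by apply: compact_closed; case: locP. Qed.

Lemma sL : L s. Proof. by case: hs => -[]. Qed.
Lemma sC t : L t -> s * t = t * s. Proof. by case: hs => -[_ +] _ _ _ _; exact. Qed.

Lemma skL k : L (s ^+ k).
Proof. by elim: k => [|k IH]; rewrite ?expg0 ?expgS; [exact: L1|exact: LM sL _]. Qed.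

Lemma skC k t : L t -> s ^+ k * t = t * s ^+ k.
Proof. by move=> Lt; apply/esym/commuteX/esym/sC. Qed.

Lemma ball_sk k : ball (s ^+ k) = conjset (s ^+ k) N0.
Proof.
apply/seteqP; split=> x; rewrite conjsetE => /= h.
  by move: h; rewrite ballP dot_L ?invgK //; exact: LV (skL k).
by rewrite ballP dot_L; [rewrite invgK|exact: LV (skL k)].
Qed.

Lemma ball_skS k : ball (s ^+ k.+1) `<=` ball (s ^+ k).
Proof.
case: hs => _ _ /(_ (Posz k)) + _ _; rewrite /Nk !ball_sk.
by rewrite -[(Posz k + 1)%R]/(Posz (k + 1)) addn1.
Qed.

Lemma Pplus_sk k : Pplus (s ^+ k).
Proof.
apply/PplusP; elim: k => [|k IH]; first by rewrite expg0 ball1.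
exact: (subset_trans (@ball_skS k) IH).
Qed.

Lemma Lplus_sk k : Lplus (s ^+ k).
Proof.
split; first exact: skL.
by rewrite -ball_sk; apply/PplusP/Pplus_sk.
Qed.

Lemma ball_mono b j k : (j <= k)%N -> ball (b * s ^+ k) `<=` ball (b * s ^+ j).
Proof.
move=> jk; apply/ball_subP.
have -> : (b * s ^+ j)^-1 * (b * s ^+ k) = s ^+ (k - j).
  by rewrite -{1}(subnKC jk) expgnDr; group_eq.
exact: Pplus_sk.
Qed.

(** The negative powers of [s] do not matter: the corresponding conjugates of
    [N0] contain [N0]. *)
Lemma ball_bigcap x : N0s x -> (forall k, ball (s ^+ k) x) -> x = 1.
Proof.
move=> hx h; suff : [set 1] x by [].
have [_ _ _ _ <-] := hs; case=> k _ /=; first by rewrite /Nk /= -ball_sk.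
rewrite /Nk /= conjsetE invgK.
exact: (Lplus_conj (Lplus_sk k.+1) hx).
Qed.

Lemma nbhs_ball b x : ball b x -> \forall y \near x, N y -> ball b y.
Proof.
case: (open_in_image b (opens_setP N0)) => O oO E; rewrite /ball E => -[Nx Ox].
by near=> y => Ny; split=> //; near: y; exact: open_nbhs_nbhs.
Unshelve. all: by end_near. Qed.

Lemma nbhs_notin_ball b x : ~ ball b x -> \forall y \near x, ~ ball b y.
Proof.
move=> nx; have := compact_closedP (@compact_ball b).
by rewrite -openC => oC; apply: (open_nbhs_nbhs (conj oC nx)).
Qed.

(** The balls [ball (s ^+ k)] form a basis of neighbourhoods of [1] in [N]:
    otherwise, by compactness, their intersection would contain a point
    outside a given neighbourhood of [1]. *)
Lemma ball_sk_basis (O : set P) : open O -> O 1 ->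
  exists k, ball (s ^+ k) `<=` O.
Proof.
move=> oO O1.
have H : \forall k \near \oo, N0s `<=` (fun x => ball (s ^+ k) x -> O x).
  apply: (proj1 (compact_near_coveringP _) compact_N0 nat \oo
    (fun k x => ball (s ^+ k) x -> O x)) => x hx.
  have [Ox|nOx] := pselect (O x).
    exists (O, setT) => /=; last by move=> [y k] [/= Oy _] _.
    by split; [exact: open_nbhs_nbhs|exact: filterT].
  have [j nj] : exists j, ~ ball (s ^+ j) x.
    apply/existsNP => h; apply: nOx.
    by rewrite (ball_bigcap hx h).
  exists (~` ball (s ^+ j), [set k | (j <= k)%N]) => /=.
    by split; [exact: nbhs_notin_ball|exists j].
  move=> [y k] [/= ny jk] yk; case: ny.
  by have := @ball_mono 1 _ _ jk; rewrite !mul1g; apply.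
have [k _ kP] := H; exists k => x hx.
by apply: (kP k) => //=; apply: (proj1 (PplusP _) (Pplus_sk k)).
Qed.

Lemma ball_basis (U : opens N) x : (U : set P) x ->
  exists k, ball (x * s ^+ k) `<=` U.
Proof.
case: U => U [O oO UE] /=; rewrite UE => -[Nx Ox].
have [||k kP] := @ball_sk_basis (fun y => O (x * y)).
- by apply: open_comp oO => y _; exact: continuous_mull.
- by rewrite mulg1.
exists k; rewrite -ball_image => _ [y hy <-].
by rewrite dot_lmul //; split; [apply: NM => //; exact: ball_subset hy|exact: kP].
Qed.

Lemma ball_sk_translate x k y : N x -> ball (x * s ^+ k) y <->
  N0s (s ^- k * (x^-1 * y) * s ^+ k).
Proof.
move=> Nx; rewrite -ball_image image_dotE ball_sk conjsetE dot_lmul //.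
exact: NV.
Qed.

Lemma ball_sk_center x k : N x -> ball (x * s ^+ k) x.
Proof.
by move=> Nx; rewrite ball_sk_translate // mulVg mulg1 mulVg; exact: N01 gN0.
Qed.

Lemma ball_sk_sub x y k : N x -> ball (x * s ^+ k) y ->
  ball (y * s ^+ k) `<=` ball (x * s ^+ k).
Proof.
move=> Nx; rewrite ball_sk_translate // => h; apply/ball_subP.
have -> : (x * s ^+ k)^-1 * (y * s ^+ k) = s ^- k * (x^-1 * y) * s ^+ k.
  by group_eq.
exact: (N0_Pplus gL h).
Qed.

(** A property of subsets that holds locally on a compact subset holds for all
    balls of some fixed radius (the Lebesgue number of the covering). *)
Lemma lebesgue_number (K : set P) (Q : set P -> Prop) :
  compact K -> K `<=` N -> (forall U V : set P, V `<=` U -> Q U -> Q V) ->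
  (forall x, K x -> exists U : opens N, (U : set P) x /\ Q U) ->
  exists k, forall x, K x -> Q (ball (x * s ^+ k)).
Proof.
move=> cK KN Qsub Qloc.
have H : \forall k \near \oo, K `<=` (fun x => N x -> Q (ball (x * s ^+ k))).
  apply: (proj1 (compact_near_coveringP _) cK nat \oo
    (fun k x => N x -> Q (ball (x * s ^+ k)))) => x Kx.
  have [U [Ux QU]] := Qloc x Kx; have [j jP] := ball_basis Ux.
  exists (fun y => N y -> ball (x * s ^+ j) y, [set k | (j <= k)%N]) => /=.
    split; last by exists j.
    by apply: nbhs_ball; apply: ball_sk_center; exact: KN.
  move=> [y k] [/= yj jk] Ny; apply: Qsub QU; apply: subset_trans jP.
  apply: subset_trans (ball_mono jk) _.
  by apply: ball_sk_sub; [exact: KN|exact: yj].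
have [k _ kP] := H; exists k => x Kx.
by apply: (kP k) => //=; exact: KN.
Qed.

(** Compactness is applied in its near-covering form, to the filter generated by
    the finite lists of points of [K] ordered by inclusion. *)
Lemma finite_translates (K : set P) t : L t -> compact K -> K `<=` N ->
  exists D : seq P, (forall d, d \in D -> K d) /\
    forall x, K x -> exists2 d, d \in D & ball (d * t) x.
Proof.
move=> Lt cK KN.
pose F : set_system (seq P) := [set X | exists2 D : seq P,
  forall d, d \in D -> K d & forall D', {subset D <= D'} -> X D'].
have FF : Filter F.
  split.
  - by exists [::].
  - move=> X Y [D DK DX] [D' DK' DY]; exists (D ++ D').
      by move=> d; rewrite mem_cat => /orP[/DK|/DK'].
    move=> D'' h; split; [apply: DX|apply: DY] => d dD; apply: h;
      by rewrite mem_cat dD ?orbT.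
  - by move=> X Y XY [D DK DX]; exists D => // D' /DX /XY.
pose Q (D : seq P) x := N x -> exists2 d, d \in D & ball (d * t) x.
have [|D DK DQ] := proj1 (compact_near_coveringP _) cK (seq P) F Q FF.
  move=> x Kx; have Nx := KN x Kx.
  exists (fun y => N y -> ball (x * t) y, [set D | x \in D]) => /=.
    split; last by exists [:: x] => [d|D]; [rewrite inE => /eqP->|apply; rewrite inE].
    apply: nbhs_ball; have := @ball_center (x * t).
    by rewrite dotM dot_lmul // dot_L // mulg1 mulgV mulg1.
  by move=> [y D] [/= yx xD] Ny; exists x => //; exact: yx.
exists D; split=> // x Kx; apply: DQ => //; exact: KN.
Qed.

Lemma ball_conjP x t y : N x -> L t ->
  ball (x * t) y <-> conjset t N0 (x^-1 * y).
Proof.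
move=> Nx Lt; rewrite -ball_image image_dotE dot_lmul; last exact: NV.
rewrite conjsetE ballP dot_L; last exact: LV.
by rewrite invgK.
Qed.

Lemma conj_cosetC t u v : conjset t N0 (u^-1 * v) -> conjset t N0 (v^-1 * u).
Proof.
by rewrite !conjsetE => /(N0V gN0); group_normalize.
Qed.

Lemma conj_coset_trans t u v w : conjset t N0 (u^-1 * v) ->
  conjset t N0 (v^-1 * w) -> conjset t N0 (u^-1 * w).
Proof.
by rewrite !conjsetE => h h'; have := N0M gN0 h h'; group_normalize.
Qed.

(** Representatives are obtained by thinning out a finite list of translates
    that covers [K]: an element is kept only if its coset is new. *)
Lemma transversal (K : set P) t : L t -> compact K -> K `<=` N ->
  exists J : seq P, [/\ uniq J, forall u, u \in J -> K u
    & forall x, K x -> exists! u, u \in J /\ conjset t N0 (u^-1 * x)].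
Proof.
move=> Lt cK KN; have [D [DK DP]] := finite_translates Lt cK KN.
suff [J [uJ JD Jinj DJ]] : exists J : seq P, [/\ uniq J, {subset J <= D},
    forall u v, u \in J -> v \in J -> conjset t N0 (u^-1 * v) -> u = v
  & forall d, d \in D -> exists2 u, u \in J & conjset t N0 (u^-1 * d)].
  exists J; split=> // [u /JD/DK //|x Kx].
  have [d dD] := DP x Kx; rewrite ball_conjP //; last exact/KN/DK.
  move=> hdx; have [u uJ' hud] := DJ d dD.
  have hux := conj_coset_trans hud hdx.
  exists u; split=> // v [vJ hvx]; apply: Jinj => //.
  exact: conj_coset_trans hux (conj_cosetC hvx).
elim: D {DK DP} => [|d D [J [uJ JD Jinj DJ]]]; first by exists [::].
have [[u uJ' hud]|nd] := pselect (exists2 u, u \in J & conjset t N0 (u^-1 * d)).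
  exists J; split=> // [v /JD vD|v]; rewrite inE; first by rewrite vD orbT.
  by case/orP => [/eqP->|/DJ //]; exists u.
exists (d :: J); split=> /=.
- rewrite uJ andbT; apply/negP => dJ; apply: nd; exists d => //.
  by rewrite mulVg conjsetE mulg1 mulVg; exact: N01 gN0.
- by move=> v; rewrite !inE => /orP[->//|/JD->]; rewrite orbT.
- move=> u v; rewrite !inE => /orP[/eqP->|uJ'] /orP[/eqP->|vJ'] // h.
  + by case: nd; exists v => //; exact: conj_cosetC.
  + by case: nd; exists u.
  + exact: Jinj.
- move=> v; rewrite inE => /orP[/eqP->|/DJ[u uJ' hu]]; last first.
    by exists u; rewrite // inE uJ' orbT.
  exists d; first exact: mem_head.
  by rewrite mulVg conjsetE mulg1 mulVg; exact: N01 gN0.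
Qed.

Lemma coset_representatives_exist t : Lplus t ->
  exists J, coset_representatives N0 t J.
Proof.
by case=> Lt _; apply: transversal => //; [exact: compact_N0|exact: opens_subset].
Qed.

(** An arbitrary ball [ball b] need not be a union of balls [ball (x * s ^+ k)],
    so the Lebesgue number is taken on [N0] and transported by [b]. *)
Lemma ball_lebesgue b (Q : set P -> Prop) :
  (forall U V : set P, V `<=` U -> Q U -> Q V) ->
  (forall x, ball b x -> exists U : opens N, (U : set P) x /\ Q U) ->
  exists k, forall u, N0s u -> Q (ball (b * (u * s ^+ k))).
Proof.
move=> Qsub Qloc.
have [||x hx|k kP] := @lebesgue_number N0s (fun U => Q (dot b @` U)) compact_N0.
- exact: opens_subset.
- by move=> U V /(@image_dotS b); exact: Qsub.
- have [|U [Ux QU]] := Qloc (dot b x); first by exists x.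
  exists (image_opens b^-1 U); split; first by apply/image_dotE; rewrite invgK.
  by rewrite /= -image_dotM mulgV image_dot1.
- by exists k => u /kP; rewrite ball_image.
Qed.

Lemma open_inD (U : opens N) (V : set P) : compact V -> open_in N (U `\` V).
Proof.
move=> /compact_closedP cV; case: U => U [O oO /= ->].
exists (O `&` ~` V); first by apply: openI => //; rewrite openC.
by rewrite setIA.
Qed.

Definition opens_diff (U : opens N) (V : set P) (cV : compact V) : opens N :=
  Opens (open_inD U cV).

Lemma open_inI (U V : opens N) : open_in N (U `&` V).
Proof.
case: U V => U [O oO /= ->] [V [O' oO' /= ->]].
by exists (O `&` O'); [exact: openI|rewrite setIACA setIid].
Qed.

Definition opens_inter (U V : opens N) : opens N := Opens (open_inI U V).

Lemma open_inT : open_in N N.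
Proof. by exists setT; [exact: openT|rewrite setIT]. Qed.

Definition opens_total : opens N := Opens open_inT.

(** High powers of [s] dominate every element of [L], as [L] is generated by
    [L_-] and [s]. *)
Lemma Lplus_absorb t : L t -> exists k, Lplus (t^-1 * s ^+ k).
Proof.
move=> Lt; have [_ LE _ _ _] := hs.
have : [set t | exists u k, Lminus L N0 u /\ t = u * expgz s k] t by rewrite -LE.
case=> u [k [hu ->]]; have [Lu _] := hu.
case: k => k /=.
  by exists k; rewrite invgM -mulgA -skC // mulKg.
exists 0%N; rewrite expg0 mulg1 invgM invgK.
exact: (LplusM gL (Lplus_sk _)).
Qed.

(** * Contractions of an etale module *)

Variable A : comPzRingType.

Local Notation Mod := (etmod A L N0).

Section Contraction.
Variable M : Mod.

(** The action of [p^-1] on [M], for [p] in [Pplus]. *)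
Definition contract (p : P) : {linear M -> M} :=
  psi M (lpart p) \o pact M (p * (lpart p)^-1)^-1.

Lemma contractE u t m : N0s u -> Lplus t ->
  contract (u * t) m = psi M t (pact M u^-1 m).
Proof.
move=> hu [Lt _]; rewrite /contract /= lpartE //; last exact: opens_subset hu.
by rewrite mulgK.
Qed.

Lemma contract_translate u w t m : N0s u -> N0s w -> Lplus t ->
  contract (u * t) (pact M (w * t) m) =
  if `[< conjset t N0 (u^-1 * w) >] then
    pact M (t^-1 * (u^-1 * w) * t) m else 0%R.
Proof.
move=> hu hw ht; rewrite contractE //.
have [pp _] := etale_psi gL gN0 (etmodP M) ht.
exact: (is_psi_translate gL gN0 m pp ht hu hw).
Qed.

Lemma contractK p m : Pplus p -> contract p (pact M p m) = m.
Proof.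
case=> u [t [hu ht ->]]; rewrite contract_translate // mulVg mulg1 mulVg pact1.
case: asboolP => // -[]; rewrite conjsetE mulg1 mulVg; exact: N01 gN0.
Qed.

Lemma contract_resolution t J m : Lplus t -> coset_representatives N0 t J ->
  m = (\sum_(u <- J) pact M (u * t)%g (contract (u * t)%g m))%R.
Proof.
move=> ht JP; have [_ res] := etale_psi gL gN0 (etmodP M) ht.
rewrite {1}[m](res _ JP); apply: eq_big_seq => u uJ.
by rewrite contractE //; case: JP => _ /(_ _ uJ).
Qed.

(** By [contract_resolution] it suffices to evaluate both sides on elements
    [pact M (w * (t * t')) m'], where [contract_translate] applies. *)
Lemma contractM p p' m : Pplus p -> Pplus p' ->
  contract (p * p') m = contract p' (contract p m).
Proof.
case=> u [t [hu ht ->]] [u' [t' [hu' ht' ->]]].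
have htt := LplusM gL ht ht'.
have [J JP] := coset_representatives_exist htt.
rewrite [m](contract_resolution _ htt JP) !linear_sum.
apply: eq_big_seq => w wJ; have hw : N0s w by case: JP => _ /(_ _ wJ).
move: (contract (w * _) m) => m'.
have -> : u * t * (u' * t') = u * (t * u' * t^-1) * (t * t') by group_eq.
have hu'' : N0s (u * (t * u' * t^-1)).
  by apply: (N0M gN0 hu); exact: (Lplus_conj ht hu').
rewrite contract_translate //.
rewrite (mulgA w) (pactM (b := w * t)); last 2 first.
- exact: (Pplus_mul hw ht).
- exact: (Lplus_Pplus gN0 ht').
rewrite contract_translate // !conjsetE.
have E : (t * t')^-1 * ((u * (t * u' * t^-1))^-1 * w) * (t * t') =
    t'^-1 * (u'^-1 * (t^-1 * (u^-1 * w) * t)) * t' by group_eq.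
rewrite E; case: asboolP => h; last first.
  case: asboolP => h'; last by rewrite linear0.
  rewrite -pactM; last 2 first.
  - exact: (N0_Pplus gL h').
  - exact: (Lplus_Pplus gN0 ht').
  rewrite contract_translate // conjsetE.
  by case: asboolP => // /h.
case: asboolP => [h'|[]]; last first.
  have := N0M gN0 hu' (Lplus_conj ht' h); by group_normalize.
rewrite -pactM; last 2 first.
- exact: (N0_Pplus gL h').
- exact: (Lplus_Pplus gN0 ht').
rewrite contract_translate // conjsetE.
by case: asboolP.
Qed.

Lemma contract_N0 u m : N0s u -> contract u m = pact M u^-1 m.
Proof.
move=> hu; have hu' := N0V gN0 hu.
rewrite -[in LHS](pact_mulVK gL gN0 m hu) contractK //; exact: (N0_Pplus gL).
Qed.

Lemma contract1 m : contract 1 m = m.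
Proof. by rewrite contract_N0 ?invg1 ?pact1 //; exact: N01 gN0. Qed.

(** Together with [contract_glue]: [M] is the module of sections over [N0] of a
    sheaf on the finite set of cosets of [s^k N0 s^-k] in [N0]. *)
Lemma contract_separated k m :
  (forall u, N0s u -> contract (u * s ^+ k) m = 0%R) -> m = 0%R.
Proof.
move=> h; have [J JP] := coset_representatives_exist (Lplus_sk k).
rewrite [m](contract_resolution _ (Lplus_sk k) JP) big1_seq // => u /andP[_ uJ].
by rewrite h ?linear0 //; case: JP => _ /(_ _ uJ).
Qed.

Lemma contract_glue k (c : P -> M) :
  (forall u v, N0s u -> N0s v -> N0s (s ^+ k * v * s ^- k) ->
     c (u * (s ^+ k * v * s ^- k)) = pact M v^-1 (c u)) ->
  exists m, forall u, N0s u -> contract (u * s ^+ k) m = c u.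
Proof.
move=> cP; have ht := Lplus_sk k.
have [J JP] := coset_representatives_exist ht; case: (JP) => _ J0 _.
exists (\sum_(u <- J) pact M (u * s ^+ k)%g (c u))%R => w hw.
rewrite linear_sum.
have [|u [uJ huw] ->] := coset_representatives_sum
  (F := fun u => contract (w * s ^+ k) (pact M (u * s ^+ k) (c u))) JP hw.
  move=> u uJ h; rewrite contract_translate //; last exact: J0.
  by case: asboolP => // /conj_cosetC.
have hu := J0 _ uJ.
rewrite contract_translate //; case: asboolP => [_|[]]; last exact: conj_cosetC.
move: huw; rewrite conjsetE => hv; set v := _ * _ * _ in hv.
have E : w = u * (s ^+ k * v * s ^- k) by rewrite /v; group_eq.
rewrite [in RHS]E cP //; last exact: (Lplus_conj ht hv).
by congr (pact M _ _); rewrite /v; group_eq.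
Qed.

(** This is where [s] being central in [L] enters: translating a ball of radius
    [k] contained in [N0] by [p] gives a ball contained in one of radius [k]. *)
Lemma shift_sk p u k : Pplus p -> N0s u -> exists2 w, N0s w &
  p * (u * s ^+ k) = w * s ^+ k * lpart p.
Proof.
move=> pP hu; have [Ll Nl] := lpartP p.
exists (dot p u); first by apply: (proj1 (PplusP _) pP); exists u.
rewrite -mulgA (skC k Ll) /Defs.dot; group_eq.
Qed.

Lemma Pplus_lpart p : Pplus p -> Lplus (lpart p).
Proof.
by case=> u [t [/opens_subset Nu ht ->]]; rewrite lpartE //; case: ht.
Qed.

(** The families that describe the sections over [U] of the sheaf of [M]: [G c]
    is the restriction of a section to [ball c], transported to [N0] by [c^-1];
    it is called the germ of the section on [ball c]. As [p] ranges over
    [Pplus], [ball (c * p)] ranges over the balls contained in [ball c], so the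
    second condition is compatibility with restriction. The value [0] on the
    balls that are not contained in [U] makes the description unique. *)
Definition is_germ (U : set P) (G : P -> M) : Prop :=
  (forall c, ~ ball c `<=` U -> G c = 0%R) /\
  (forall c p, Pplus p -> ball c `<=` U -> G (c * p) = contract p (G c)).

Lemma ballMr c p : Pplus p -> ball (c * p) `<=` ball c.
Proof. by move=> hp; apply/ball_subP; rewrite mulKg. Qed.

Lemma Pplus_ball u k : N0s u -> Pplus (u * s ^+ k).
Proof. by move=> hu; apply: Pplus_mul => //; exact: Lplus_sk. Qed.

(** On [ball c] the two families agree on all balls of a fixed small radius, and
    these determine the values at [c] by [contract_separated]. *)
Lemma germ_eq (U : opens N) (G G' : P -> M) : is_germ U G -> is_germ U G' ->
  (forall x, (U : set P) x -> exists V : opens N, (V : set P) x /\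
     forall c, ball c `<=` U -> ball c `<=` V -> G c = G' c) ->
  G = G'.
Proof.
move=> [G0 GM] [G'0 G'M] loc; apply/funext => c.
have [cU|ncU] := pselect (ball c `<=` U); last by rewrite G0 // G'0.
have [||k kP] := @ball_lebesgue c (fun W => forall c, ball c `<=` U ->
  ball c `<=` W -> G c = G' c).
- by move=> V W WV h b bU bW; apply: h => //; exact: (subset_trans bW WV).
- by move=> x /cU /loc.
apply/eqP; rewrite -GRing.subr_eq0; apply/eqP/(@contract_separated k) => u hu.
have hp := Pplus_ball k hu.
rewrite linearB -GM // -G'M // (kP u hu) ?GRing.subrr //.
exact: (subset_trans (ballMr hp) cU).
Qed.

(** Germs may be prescribed on the small balls only: the value on an arbitrary
    ball [c] is the element of [M] whose contractions are the prescribed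
    values on the small balls contained in [c]. That it has the right
    contraction for every [p], and not only for those of the chosen radius,
    uses that [s] is central in [L]. *)
Lemma germ_extend (U : opens N) (good : P -> Prop) (G0 : P -> M) :
  (forall c p, ball c `<=` U -> good c -> Pplus p ->
     good (c * p) /\ G0 (c * p) = contract p (G0 c)) ->
  (forall x, (U : set P) x -> exists V : opens N, (V : set P) x /\
     forall c, ball c `<=` U -> ball c `<=` V -> good c) ->
  exists2 G, is_germ U G & forall c, ball c `<=` U -> good c -> G c = G0 c.
Proof.
move=> goodM loc.
have radius c : ball c `<=` U ->
    exists k, forall u, N0s u -> good (c * (u * s ^+ k)).
  move=> cU; have [||k kP] := @ball_lebesgue c (fun W => forall c,
    ball c `<=` U -> ball c `<=` W -> good c).
  - by move=> V W WV h b bU bW; apply: h => //; exact: (subset_trans bW WV).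
  - by move=> x /cU /loc.
  exists k => u hu; apply: kP (hu) _ _ _ => //.
  exact: (subset_trans (ballMr (Pplus_ball k hu)) cU).
pose S c := [set m : M | ball c `<=` U /\
  forall p, Pplus p -> good (c * p) -> contract p m = G0 (c * p)].
have Suniq c m m' : S c m -> S c m' -> m = m'.
  move=> [cU h] [_ h']; have [k kP] := radius c cU.
  apply/eqP; rewrite -GRing.subr_eq0; apply/eqP/(@contract_separated k) => u hu.
  have hp := Pplus_ball k hu.
  by rewrite linearB h ?h' ?GRing.subrr //; exact: kP.
have Sex c : ball c `<=` U -> exists m, S c m.
  move=> cU; have [k kP] := radius c cU.
  have inU p : Pplus p -> ball (c * p) `<=` U.
    by move=> hp; exact: (subset_trans (ballMr hp) cU).
  have [|m mP] := @contract_glue k (fun u => G0 (c * (u * s ^+ k))).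
    move=> u v hu hv hv'.
    have -> : c * (u * (s ^+ k * v * s ^- k) * s ^+ k) = c * (u * s ^+ k) * v.
      by group_eq.
    have [_ ->] := goodM _ v (inU _ (Pplus_ball k hu)) (kP _ hu)
      (N0_Pplus gL hv).
    by rewrite contract_N0.
  exists m; split=> // p hp gp.
  apply/eqP; rewrite -GRing.subr_eq0; apply/eqP/(@contract_separated k) => u hu.
  have hus := Pplus_ball k hu.
  have [w hw E] := shift_sk k hp hu.
  have hl := Pplus_lpart hp; have hl' := Lplus_Pplus gN0 hl.
  have hws := Pplus_ball k hw.
  rewrite linearB -contractM // E contractM // mP //.
  have [_ <-] := goodM _ (lpart p) (inU _ hws) (kP _ hw) hl'.
  have [_ <-] := goodM _ (u * s ^+ k) (inU _ hp) gp hus.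
  by rewrite -!mulgA E !mulgA GRing.subrr.
pose G c := xget 0%R (S c).
have GS c : ball c `<=` U -> S c (G c).
  by move=> /Sex[m Sm]; rewrite /G; case: xgetP => [m' -> //|/(_ m)].
exists G => [|c cU gc].
  split=> [c ncU|c p hp cU].
    by rewrite /G; case: xgetP => // m _ [/ncU].
  have cpU : ball (c * p) `<=` U by exact: (subset_trans (ballMr hp) cU).
  apply: (Suniq (c * p)); first exact: GS.
  split=> // p' hp' gp; have [_ h] := GS c cU.
  rewrite -contractM // h ?mulgA //.
  exact: (PplusM gL gN0 hp hp').
have [_ h] := GS c cU.
have := h 1 (N0_Pplus gL (N01 gN0)); rewrite mulg1 contract1; exact.
Qed.

(** * The equivariant sheaf of an etale module *)

Lemma germ_submodule (U : set P) : submodule_property (is_germ U).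
Proof.
split=> [|a G G' [G0 GM] [G'0 G'M]]; first by split=> // c p _ _; rewrite linear0.
split=> [c ncU|c p hp cU]; rewrite !fctE.
  by rewrite G0 // G'0 // GRing.scaler0 GRing.addr0.
by rewrite linearP GM // G'M.
Qed.

Definition sheaf_module (U : opens N) : lmodType A :=
  submodule (germ_submodule U).

Definition germ (U : opens N) (x : sheaf_module U) : P -> M :=
  submodule_val x.

Definition mk_section (U : opens N) (G : P -> M) (hG : is_germ U G) :
  sheaf_module U := Submodule (introT (asboolP _) hG).

Lemma germP U (x : sheaf_module U) : is_germ U (germ x).
Proof. exact/asboolP/(submodule_valP x). Qed.

Lemma germ_inj U : injective (@germ U).
Proof. exact: val_inj. Qed.

Lemma germ_linear U a (x y : sheaf_module U) c :
  germ (a *: x + y)%R c = (a *: germ x c + germ y c)%R.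
Proof. by []. Qed.

Lemma germ0 U c : germ (0%R : sheaf_module U) c = 0%R.
Proof. by []. Qed.

Definition germ_restrict (V : set P) (G : P -> M) (c : P) : M :=
  if `[< ball c `<=` V >] then G c else 0%R.

Lemma germ_restrictT (V : set P) G c : ball c `<=` V -> germ_restrict V G c = G c.
Proof. by rewrite /germ_restrict; case: asboolP. Qed.

Lemma germ_restrictF (V : set P) G c :
  ~ ball c `<=` V -> germ_restrict V G c = 0%R.
Proof. by rewrite /germ_restrict; case: asboolP. Qed.

Lemma germ_restrictP (U V : set P) G :
  V `<=` U -> is_germ U G -> is_germ V (germ_restrict V G).
Proof.
move=> VU [G0 GM]; split=> [c ncV|c p hp cV]; first exact: germ_restrictF.
rewrite !germ_restrictT // ?GM //; first exact: subset_trans VU.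
exact: (subset_trans (ballMr hp) cV).
Qed.

Definition restrict_fun (U V : opens N) (h : V `<=` U) (x : sheaf_module U) :
  sheaf_module V := mk_section (germ_restrictP h (germP x)).

Lemma restrict_fun_linear (U V : opens N) (h : V `<=` U) :
  linear (restrict_fun h).
Proof.
move=> a x y; apply: germ_inj; apply/funext => c.
rewrite germ_linear /germ /= /germ_restrict.
by case: asboolP => // _; rewrite GRing.scaler0 GRing.addr0.
Qed.

Definition restrict (U V : opens N) (h : V `<=` U) :
  {linear sheaf_module U -> sheaf_module V} := mk_linear (restrict_fun_linear h).

Lemma restrictT (U V : opens N) (h : V `<=` U) x c :
  ball c `<=` V -> germ (restrict h x) c = germ x c.
Proof. exact: germ_restrictT. Qed.

Lemma germF U (x : sheaf_module U) c : ~ ball c `<=` U -> germ x c = 0%R.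
Proof. by case: (germP x) => + _; exact. Qed.

Lemma germM U (x : sheaf_module U) c p : Pplus p -> ball c `<=` U ->
  germ x (c * p) = contract p (germ x c).
Proof. by case: (germP x) => _; exact. Qed.

Lemma section_eq U (x y : sheaf_module U) :
  (forall c, ball c `<=` U -> germ x c = germ y c) -> x = y.
Proof.
move=> h; apply: germ_inj; apply/funext => c.
by have [/h //|n] := pselect (ball c `<=` U); rewrite !germF.
Qed.

Lemma restrict_id (U : opens N) (h : U `<=` U) x : restrict h x = x.
Proof. by apply: section_eq => c cU; rewrite restrictT. Qed.

Lemma restrict_comp (U V W : opens N) (hV : V `<=` U) (hW : W `<=` V)
  (h : W `<=` U) x : restrict hW (restrict hV x) = restrict h x.
Proof.
apply: section_eq => c cW; rewrite !restrictT //.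
exact: (subset_trans cW hW).
Qed.

Lemma section_eq_local U (x y : sheaf_module U) :
  (forall z, (U : set P) z -> exists V : opens N, (V : set P) z /\
     forall c, ball c `<=` U -> ball c `<=` V -> germ x c = germ y c) ->
  x = y.
Proof. by move=> h; apply: germ_inj; exact: germ_eq (germP x) (germP y) h. Qed.

(** The given sections prescribe the germs on the balls contained in some member
    of the covering. *)
Lemma restrict_glue (U : opens N) (C : set (opens N))
    (CU : forall V : opens N, C V -> V `<=` U) :
  U `<=` [set x | exists2 V : opens N, C V & (V : set P) x] ->
  forall x : (forall V : opens N, C V -> sheaf_module V),
  (forall (V W O : opens N) (CV : C V) (CW : C W)
     (hV : O `<=` V) (hW : O `<=` W), restrict hV (x V CV) = restrict hW (x W CW)) ->
  exists! y : sheaf_module U, forall (V : opens N) (CV : C V),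
    restrict (CU V CV) y = x V CV.
Proof.
move=> cov x compat.
pose S c := [set m : M | exists (V : opens N) (CV : C V),
  ball c `<=` V /\ m = germ (x V CV) c].
pose G0 c := xget 0%R (S c).
have G0E c V (CV : C V) : ball c `<=` V -> G0 c = germ (x V CV) c.
  move=> cV; rewrite /G0; case: xgetP => [m -> [W [CW [cW ->]]]|]; last first.
    by case/(_ (germ (x V CV) c)); exists V, CV.
  have /(congr1 (fun y => germ y c)) := compat V W (ball_opens c) CV CW cV cW.
  by rewrite !restrictT.
have [||G hG GE] := @germ_extend U
  (fun c => exists2 V : opens N, C V & ball c `<=` V) G0.
- move=> c p cU [V CV cV] hp.
  have cpV : ball (c * p) `<=` V by exact: (subset_trans (ballMr hp) cV).
  split; first by exists V.
  by rewrite !(G0E _ _ CV) // germM.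
- by move=> z /cov[V CV Vz]; exists V; split=> // c _ cV; exists V.
exists (mk_section hG); split=> [V CV|y yP].
  apply: section_eq => c cV; rewrite restrictT //.
  rewrite -(G0E _ _ CV) //; apply: GE; last by exists V.
  exact: (subset_trans cV (CU _ CV)).
apply: section_eq_local => z /cov[V CV Vz]; exists V; split=> // c cU cV.
rewrite [LHS]GE //; last by exists V.
by rewrite (G0E _ _ CV) // -(yP V CV) restrictT.
Qed.

Definition germ_sheaf : sheaf A N :=
  Sheaf restrict_id restrict_comp restrict_glue.

Lemma germ_translateP b (U V : opens N) (h : V = dot b @` U :> set P) G :
  is_germ U G -> is_germ V (fun c => G (b^-1 * c)).
Proof.
have E c : ball c `<=` V <-> ball (b^-1 * c) `<=` U.
  rewrite h -ball_image; split=> [/(@image_dotS b^-1)|/(@image_dotS b)].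
    by rewrite image_dotK.
  by rewrite image_dotVK.
case=> G0 GM; split=> [c|c p hp]; rewrite E => cV; first exact: G0.
by rewrite mulgA GM.
Qed.

Definition translate_fun b (U V : opens N) (h : V = dot b @` U :> set P)
  (x : sheaf_module U) : sheaf_module V :=
  mk_section (germ_translateP h (germP x)).

Lemma translate_fun_linear b (U V : opens N) (h : V = dot b @` U :> set P) :
  linear (translate_fun h).
Proof. by move=> a x y; apply: germ_inj. Qed.

Definition translate b (U V : opens N) (h : V = dot b @` U :> set P) :
  {linear sheaf_module U -> sheaf_module V} :=
  mk_linear (translate_fun_linear h).

Lemma translateE b (U V : opens N) (h : V = dot b @` U :> set P) x c :
  germ (translate h x) c = germ x (b^-1 * c).
Proof. by []. Qed.

Lemma translate1 (U : opens N) (h : U = dot 1 @` U :> set P) x :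
  translate h x = x.
Proof. by apply: section_eq => c _; rewrite translateE invg1 mul1g. Qed.

Lemma translateM (b c : P) (U V W : opens N) (hV : V = dot c @` U :> set P)
    (hW : W = dot b @` V :> set P) (h : W = dot (b * c) @` U :> set P) x :
  translate h x = translate hW (translate hV x).
Proof. by apply: section_eq => d _; rewrite !translateE invgM mulgA. Qed.

Lemma translate_res (b : P) (U V U' V' : opens N)
    (h : V = dot b @` U :> set P) (h' : V' = dot b @` U' :> set P)
    (i : U' `<=` U) (j : V' `<=` V) x :
  res germ_sheaf j (translate h x) = translate h' (res germ_sheaf i x).
Proof.
apply: section_eq => c cV'; rewrite restrictT // !translateE restrictT //.
have := @image_dotS b^-1 _ _ cV'.
by rewrite h' ball_image image_dotK.
Qed.

Definition germ_eqsheaf : eqsheaf A N L :=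
  @EqSheaf A P N L germ_sheaf translate translate1 translateM translate_res.

End Contraction.

Section GermMorphism.
Variables (M M' : Mod) (f : ethom M M').

Lemma ethom_contract p m : Pplus p -> f (contract M p m) = contract M' p (f m).
Proof.
case=> u [t [hu ht ->]]; rewrite !contractE // (ethom_psi gL gN0) //.
by rewrite ethomP //; exact: (N0_Pplus gL (N0V gN0 hu)).
Qed.

Lemma germ_mapP (U : set P) (G : P -> M) :
  is_germ U G -> is_germ (M := M') U (f \o G).
Proof.
case=> G0 GM; split=> [c nc|c p hp cU] /=; first by rewrite G0 // linear0.
by rewrite GM // ethom_contract.
Qed.

Definition germ_map_fun (U : opens N) (x : sheaf_module M U) :
  sheaf_module M' U := mk_section (germ_mapP (germP x)).

Lemma germ_map_fun_linear U : linear (@germ_map_fun U).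
Proof.
by move=> a x y; apply: germ_inj; apply/funext => c; rewrite /germ /= linearP.
Qed.

Definition germ_map U : {linear sheaf_module M U -> sheaf_module M' U} :=
  mk_linear (@germ_map_fun_linear U).

Lemma germ_mapE U x c : germ (@germ_map U x) c = f (germ x c).
Proof. by []. Qed.

Lemma germ_map_res (U V : opens N) (i : V `<=` U) x :
  germ_map V (res (germ_sheaf M) i x) = res (germ_sheaf M') i (germ_map U x).
Proof.
by apply: section_eq => c cV; rewrite germ_mapE !restrictT.
Qed.

Lemma germ_map_act b (U V : opens N) (h : V = dot b @` U :> set P) x :
  germ_map V (sact (germ_eqsheaf M) h x) =
  sact (germ_eqsheaf M') h (germ_map U x).
Proof. exact: section_eq. Qed.

Definition germ_eqshom : eqshom (germ_eqsheaf M) (germ_eqsheaf M') :=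
  @EqsHom _ _ _ _ (germ_eqsheaf M) (germ_eqsheaf M') germ_map germ_map_res
    germ_map_act.

End GermMorphism.

Definition germ_functor : functor (EtaleModules A L N0) (EquivariantSheaves A N L).
Proof.
refine (@Functor (EtaleModules A L N0) (EquivariantSheaves A N L)
  germ_eqsheaf germ_eqshom _ _) => *;
  by apply: eqshom_eqP => U x; apply: section_eq.
Defined.

(** * The induced module and the operators Res *)

Section Restriction.
Variable M : Mod.

(** The monoid [Pplus^-1] acts on [M] by contractions, and the inverse turns left
    multiplication of the argument into right multiplication. *)
Lemma induced_germP (f : P -> M) :
  is_induced f <-> is_germ opens_total (fun c => f c^-1).
Proof.
split=> [If|[_ GM] u t x hu ht].
  split=> [c []|c p [u [t [hu ht ->]]] _]; first exact: ball_subset.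
  by rewrite invgM If // contractE.
have := GM x^-1 (u * t) (Pplus_mul hu ht) (@ball_subset _).
by rewrite contractE // invgM !invgK.
Qed.

Lemma MP_germ (f : MP M) : is_germ opens_total (fun c => f c^-1).
Proof. by case: f => f /= /asboolP /induced_germP. Qed.

Lemma germ_MP (G : P -> M) : is_germ opens_total G ->
  exists f : MP M, forall c, f c^-1 = G c.
Proof.
move=> hG; have If : is_induced (fun x => G x^-1).
  by apply/induced_germP; under [fun _ => _]eq_fun do rewrite invgK.
by exists (mkMP (introT (asboolP _) If)) => c /=; rewrite invgK.
Qed.

Lemma MP_eqP (f f' : MP M) : (forall c, f c^-1 = f' c^-1) -> f = f'.
Proof. by move=> h; apply: val_inj; apply/funext => x; rewrite -[x]invgK; exact: h. Qed.

Lemma MP_eq_local (f f' : MP M) :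
  (forall x, N x -> exists V : opens N, (V : set P) x /\
     forall c, ball c `<=` V -> f c^-1 = f' c^-1) -> f = f'.
Proof.
move=> h; apply: MP_eqP => c.
suff /(congr1 (fun g => g c)) : (fun c => f c^-1) = (fun c => f' c^-1) by [].
apply: (germ_eq (MP_germ f) (MP_germ f')) => x /h[V [Vx VP]].
by exists V; split=> // d _; exact: VP.
Qed.

Lemma MPM (f : MP M) c p : Pplus p -> f (c * p)^-1 = contract M p (f c^-1).
Proof. by move=> hp; case: (MP_germ f) => _ /(_ c p hp (@ball_subset _)). Qed.

(** For [c = n * t] and [k] large, [t * s ^+ k] lies in [Lplus], so each point
    [c * (u * s ^+ k)] is of the form [n' * p] with [n'] in [N] and [p] in
    [Pplus]; hence the contractions of [f c^-1] at radius [k] are determined by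
    the values on [N]. *)
Lemma MP_eq_on_N (f f' : MP M) : (forall n, N n -> f n = f' n) -> f = f'.
Proof.
move=> h; apply: MP_eqP => c; have [Ll Nl] := lpartP c.
have [k hk] := Lplus_absorb (LV Ll); rewrite invgK in hk.
apply/eqP; rewrite -GRing.subr_eq0; apply/eqP/(@contract_separated _ k) => u hu.
have hp := Pplus_ball k hu.
have E : c * (u * s ^+ k) =
    (c * u * c^-1 * (c * (lpart c)^-1)) * (lpart c * s ^+ k) by group_eq.
have hk' := Lplus_Pplus gN0 hk.
rewrite linearB -!MPM // E (MPM f) // (MPM f') // h ?GRing.subrr //.
apply: NV; apply: NM => //; apply: NJ; exact: opens_subset hu.
Qed.

Section Multiplication.
Variable phi : Ccinf A N.

Definition constant_on_ball (c : P) : Prop :=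
  forall x, ball c x -> phi x = phi (dot c 1).

Lemma locally_constant x : N x -> exists V : opens N, (V : set P) x /\
  forall c, ball c `<=` V -> constant_on_ball c.
Proof.
move=> Nx; have /asboolP[_ loc _] := CcvalP phi.
have [U [oU Ux] UP] := loc x Nx.
exists (Opens oU); split=> // c cU y cy /=.
transitivity (phi x); first exact/UP/cU.
by apply/esym/UP/cU; exact: ball_center.
Qed.

Lemma constant_on_ballM c p : Pplus p -> constant_on_ball c ->
  phi (dot (c * p) 1) = phi (dot c 1) /\ constant_on_ball (c * p).
Proof.
move=> hp h; have E : phi (dot (c * p) 1) = phi (dot c 1).
  by apply: h; apply: (ballMr hp); exact: ball_center.
by split=> // x /(ballMr hp) /h ->.
Qed.

(** Says that [h] is the product of the section [f] by the function [phi],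
    which is constant on small balls. *)
Definition is_multiple (f h : MP M) : Prop := forall c,
  constant_on_ball c -> h c^-1 = ((phi (dot c 1%g) : A) *: f c^-1%g)%R.

Lemma multiple_exists f : exists h, is_multiple f h.
Proof.
have [||G hG GE] := @germ_extend M opens_total constant_on_ball
  (fun c => (phi (dot c 1%g) : A) *: f c^-1%g)%R.
- move=> c p _ hc hp; have [-> hcp] := constant_on_ballM hp hc.
  by split=> //; rewrite linearZ MPM.
- by move=> x /locally_constant[V [Vx VP]]; exists V; split=> // c _; exact: VP.
have [h hE] := germ_MP hG; exists h => c hc.
by rewrite hE GE //; exact: ball_subset.
Qed.

Lemma multiple_uniq f h h' : is_multiple f h -> is_multiple f h' -> h = h'.
Proof.
move=> hP h'P; apply: MP_eq_local => x /locally_constant[V [Vx VP]].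
by exists V; split=> // c /VP hc; rewrite hP // h'P.
Qed.

Definition multiply_fun (f : MP M) : MP M := xget 0%R (is_multiple f).

Lemma multiply_funP f : is_multiple f (multiply_fun f).
Proof.
have [h hP] := multiple_exists f.
by rewrite /multiply_fun; case: xgetP => [h' _ //|/(_ h)].
Qed.

Lemma multiply_fun_linear : linear multiply_fun.
Proof.
move=> a f g; apply: (@multiple_uniq (a *: f + g)%R); first exact: multiply_funP.
move=> c hc; rewrite /= !fctE !multiply_funP //.
by rewrite GRing.scalerDr !GRing.scalerA GRing.mulrC.
Qed.

Definition multiply : {linear MP M -> MP M} := mk_linear multiply_fun_linear.

Lemma multiplyE f c : constant_on_ball c ->
  multiply f c^-1 = ((phi (dot c 1%g) : A) *: f c^-1%g)%R.
Proof. exact: multiply_funP. Qed.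

End Multiplication.

Lemma multiply_linear (a : A) (f g : Ccinf A N) m :
  multiply (a *: f + g)%R m = (a *: multiply f m + multiply g m)%R.
Proof.
apply: MP_eq_local => x Nx.
have [U [Ux UP]] := locally_constant (a *: f + g)%R Nx.
have [V [Vx VP]] := locally_constant f Nx.
have [W [Wx WP]] := locally_constant g Nx.
exists (opens_inter U (opens_inter V W)); split=> // c cUVW.
rewrite (multiplyE _ (UP c _)); last by move=> y /cUVW[].
rewrite /= !fctE (multiplyE _ (VP c _)); last by move=> y /cUVW[_ []].
rewrite (multiplyE _ (WP c _)); last by move=> y /cUVW[_ []].
by rewrite GRing.scalerDl GRing.scalerA.
Qed.

Lemma CcactE b (f : Ccinf A N) x : Ccact L b f x = f (dot b^-1 x).
Proof.
rewrite /Ccact insubdK //; apply/asboolP.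
have /asboolP[f0 loc [K [cK KN] fK]] := CcvalP f.
have imN y : N (dot b^-1 y) -> N y by move/(dotN b); rewrite dotVK.
split.
- by move=> y nNy; apply: f0 => /imN.
- move=> y Ny; have [U [oU Uy] UP] := loc _ (dotN b^-1 Ny).
  exists (dot b @` U) => [|z /image_dotE Uz]; last exact: UP.
  by split; [exact: open_in_image|apply/image_dotE].
- exists (dot b @` K); first split.
  + exact: compact_image.
  + by move=> _ [y /KN Ny <-]; exact: dotN.
  + by move=> y nK; apply: fK => h; apply: nK; apply/image_dotE.
Qed.

Lemma multiply_equivariant b (f : Ccinf A N) m :
  multiply (Ccact L b f) m = rtrans b (multiply f (rtrans b^-1 m)).
Proof.
apply: MP_eq_local => x Nx.
have [U [Ux UP]] := locally_constant (Ccact L b f) Nx.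
have [V [Vx VP]] := locally_constant f (dotN b^-1 Nx).
exists (opens_inter U (image_opens b V)); split=> [|c cUV].
  by split=> //; apply/image_dotE.
rewrite (multiplyE _ (UP c _)); last by move=> y /cUV[].
rewrite /= CcactE.
have -> : c^-1 * b = (b^-1 * c)^-1 by group_eq.
rewrite (multiplyE _ (VP _ _)) /= -?dotM //; first by congr (_ *: m _)%R; group_eq.
rewrite -ball_image => _ [y /cUV[_ /image_dotE hy] <-]; exact: hy.
Qed.

Lemma CcindE (U : opens N) x :
  compact U -> Ccind A N U x = \1_(U : set P) x.
Proof.
move=> cU; rewrite /Ccind insubdK //; apply/asboolP.
split.
- move=> y nNy; rewrite indicE memNset // => /opens_subset; exact: nNy.
- move=> y Ny; have [Uy|nUy] := pselect ((U : set P) y).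
    exists U; first by split=> //; exact: opens_setP.
    by move=> z Uz; rewrite !indicE !mem_set.
  exists (N `\` U) => [|z [_ nUz]]; last by rewrite !indicE !memNset.
  by split=> //; exact: (open_inD opens_total).
- exists (U : set P); first by split=> //; exact: opens_subset.
  by move=> y nUy; rewrite indicE memNset.
Qed.

Lemma multiply_ind (U : opens N) (cU : compact U) f c :
  (ball c `<=` U -> multiply (Ccind A N U) f c^-1 = f c^-1) /\
  (ball c `<=` ~` (U : set P) -> multiply (Ccind A N U) f c^-1 = 0%R).
Proof.
split=> h; rewrite multiplyE.
- by rewrite CcindE // indicE mem_set ?GRing.scale1r //; exact/h/ball_center.
- move=> x /h Ux; rewrite !CcindE // !indicE !mem_set //.
  exact/h/ball_center.
- by rewrite CcindE // indicE memNset ?GRing.scale0r //; exact/h/ball_center.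
- move=> x /h Ux; rewrite !CcindE // !indicE !memNset //.
  exact/h/ball_center.
Qed.

(** The product has the two properties that define [sigma0 (ev0 m)], and
    [MP_eq_on_N] shows that they determine an element of [MP M]. *)
Lemma multiply_N0 m : multiply (Ccind A N N0) m = sigma0 N (ev0 m).
Proof.
pose S := [set f : MP M | (forall n, N0s n -> f n = pact M n (ev0 m)) /\
  (forall n, N n -> ~ N0s n -> f n = 0%R)].
have SP : S (multiply (Ccind A N N0) m).
  split=> [n hn|n Nn nn].
    have [+ _] := multiply_ind compact_N0 m n^-1; rewrite invgK => ->.
      rewrite /ev0 -[in LHS](invgK n) -[in LHS](mul1g n^-1) MPM; last first.
        exact: (N0_Pplus gL (N0V gN0 hn)).
      by rewrite contract_N0 ?invgK ?invg1 //; exact: (N0V gN0 hn).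
    exact: (proj1 (PplusP _) (N0_Pplus gL (N0V gN0 hn))).
  have [_ +] := multiply_ind compact_N0 m n^-1; rewrite invgK; apply.
  move=> _ [y hy <-]; rewrite dot_lmul; last exact: NV.
  move=> h; apply: nn; have := N0M gN0 hy (N0V gN0 h); group_normalize.
  by [].
have Suniq f f' : S f -> S f' -> f = f'.
  move=> [f1 f0] [f'1 f'0]; apply: MP_eq_on_N => n Nn.
  by have [hn|nn] := pselect (N0s n); [rewrite f1 ?f'1|rewrite f0 ?f'0].
rewrite /sigma0; case: xgetP => [h _ hS|/(_ (multiply (Ccind A N N0) m))//].
exact: (Suniq _ _ SP hS).
Qed.

Lemma multiply_is_Res : is_Res (M := M) multiply.
Proof.
by split; [exact: multiply_linear|exact: multiply_equivariant|exact: multiply_N0].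
Qed.

(** [Res] is chosen among the operators satisfying [is_Res]; only its values on
    indicator functions of compact open sets are needed, and there all choices
    coincide. *)
Section ResUnique.
Variable R : Ccinf A N -> {linear MP M -> MP M}.
Hypothesis RP : is_Res R.

Definition agrees (phi : Ccinf A N) : Prop := R phi =1 multiply phi.

Lemma agrees0 : agrees 0%R.
Proof.
have Z (R' : Ccinf A N -> {linear MP M -> MP M}) : is_Res R' ->
    forall m, R' 0%R m = 0%R.
  move=> [lR _ _] m; have := lR (-1)%R 0%R 0%R m.
  by rewrite GRing.scaler0 GRing.addr0 GRing.scaleN1r GRing.addNr.
by move=> m; rewrite !Z //; exact: multiply_is_Res.
Qed.

Lemma agreesD f g : agrees f -> agrees g -> agrees (f + g)%R.
Proof.
move=> Ef Eg m; case: RP => lR _ _; rewrite -[f]GRing.scale1r lR.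
by rewrite multiply_linear Ef Eg.
Qed.

Lemma agrees_ball b : agrees (Ccact L b (Ccind A N N0)).
Proof.
move=> m; case: RP => _ eR R0; rewrite eR multiply_equivariant.
by rewrite R0 multiply_N0.
Qed.

(** The indicator function of [U] is the sum of those of finitely many balls,
    which are translates of that of [N0]. *)
Lemma agrees_ind (U : opens N) : compact U -> agrees (Ccind A N U).
Proof.
move=> cU; have UN := @opens_subset U.
have [||k kP] := @lebesgue_number U (fun V => V `<=` U) cU UN.
- by move=> V W WV VU; exact: (subset_trans WV VU).
- by move=> x Ux; exists U; split.
have [J [uJ JU JP]] := transversal (skL k) cU UN.
suff -> : Ccind A N U = (\sum_(u <- J) Ccact L (u * s ^+ k)%g (Ccind A N N0))%R.
  apply: big_ind; [exact: agrees0|exact: agreesD|move=> u _; exact: agrees_ball].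
apply: val_inj; apply/funext => x; rewrite [LHS]CcindE //.
have sumE (I : seq P) (F : P -> Ccinf A N) :
    (\sum_(u <- I) F u)%R x = (\sum_(u <- I) F u x)%R.
  by elim/big_rec2: _ => // u y f _ <-.
rewrite [RHS]sumE.
have E u : u \in J -> Ccact L (u * s ^+ k) (Ccind A N N0) x =
    \1_(conjset (s ^+ k) N0) (u^-1 * x).
  move=> uJ'; rewrite CcactE CcindE ?indicE; last exact: compact_N0.
  congr (_%:R)%R; congr (nat_of_bool _); apply/idP/idP; rewrite !inE.
    by rewrite -ballP ball_conjP //; [exact/UN/JU|exact: skL].
  by rewrite -ballP ball_conjP //; [exact/UN/JU|exact: skL].
rewrite big_seq (eq_bigr _ E) -big_seq.
have [Ux|nUx] := pselect ((U : set P) x).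
  have [u [[uJ' hu] uu]] := JP x Ux.
  rewrite (bigD1_seq u) //= !indicE !mem_set // big1_seq ?GRing.addr0 //.
  move=> v /andP[vu vJ]; rewrite indicE memNset // => hv.
  by case/eqP: vu; rewrite (uu v).
rewrite indicE memNset // big1_seq // => u /andP[_ uJ'].
rewrite indicE memNset // => hu; apply: nUx; apply: (kP u (JU _ uJ')).
by apply/ball_conjP => //; [exact/UN/JU|exact: skL].
Qed.

End ResUnique.

Lemma ResE (U : opens N) (cU : compact U) :
  Res M (Ccind A N U) =1 multiply (Ccind A N U).
Proof.
apply: agrees_ind => //; rewrite /Res.
by case: xgetP => [R -> //|/(_ multiply)]; case; exact: multiply_is_Res.
Qed.

(** When [U] is compact and open, it is open and closed in [N], so every small
    enough ball satisfies this condition. *)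
Definition decided (U : set P) (c : P) : Prop :=
  ball c `<=` U \/ ball c `<=` ~` U.

Lemma decidedM (U : set P) c p : Pplus p -> decided U c -> decided U (c * p).
Proof.
by move=> hp [h|h]; [left|right]; exact: (subset_trans (ballMr hp) h).
Qed.

Lemma locally_decided (U : opens N) : compact U ->
  forall x, N x -> exists V : opens N, (V : set P) x /\
    forall c, ball c `<=` V -> decided U c.
Proof.
move=> cU x Nx; have [Ux|nUx] := pselect ((U : set P) x).
  by exists U; split=> // c; left.
by exists (opens_diff opens_total cU); split=> // c cU'; right => y /cU'[].
Qed.

Lemma ball_not_both (U : set P) c : ball c `<=` ~` U -> ~ ball c `<=` U.
Proof. by move=> h h'; apply: (h _ (ball_center c)); exact/h'/ball_center. Qed.

Section ExtensionByZero.
Variables (U : opens N) (cU : compact U).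

Definition is_extension (x : sheaf_module M U) (f : MP M) : Prop :=
  forall c, decided U c -> f c^-1 = germ x c.

Lemma extension_exists x : exists f, is_extension x f.
Proof.
have [||G hG GE] := @germ_extend M opens_total (decided U) (germ x).
- move=> c p _ hc hp; split; first exact: decidedM.
  case: hc => hc; first by rewrite germM.
  have hcp := subset_trans (ballMr hp) hc.
  by rewrite !germF ?linear0 //; exact: ball_not_both.
- move=> z /(locally_decided cU)[V [Vz VP]]; exists V; split=> // c _.
  exact: VP.
have [f fE] := germ_MP hG; exists f => c hc.
by rewrite fE GE //; exact: ball_subset.
Qed.

Lemma MP_eq_decided (f f' : MP M) :
  (forall c, decided U c -> f c^-1 = f' c^-1) -> f = f'.
Proof.
move=> h; apply: MP_eq_local => x /(locally_decided cU)[V [Vx VP]].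
by exists V; split=> // c /VP; exact: h.
Qed.

Definition extension_fun (x : sheaf_module M U) : MP M :=
  xget 0%R (is_extension x).

Lemma extension_funP x : is_extension x (extension_fun x).
Proof.
have [f fP] := extension_exists x.
by rewrite /extension_fun; case: xgetP => [f' _ //|/(_ f)].
Qed.

Lemma extension_fun_linear : linear extension_fun.
Proof.
move=> a x y; apply: MP_eq_decided => c hc.
by rewrite /= !fctE !extension_funP.
Qed.

Definition extension : {linear sheaf_module M U -> MP M} :=
  mk_linear extension_fun_linear.

Lemma extensionE x c : decided U c -> extension x c^-1 = germ x c.
Proof. exact: extension_funP. Qed.

Lemma extension_inj : injective extension.
Proof.
move=> x y E; apply: section_eq => c cU'.
by rewrite -!extensionE ?E //; left.
Qed.

Lemma Res_extension x : Res M (Ccind A N U) (extension x) = extension x.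
Proof.
apply: MP_eq_decided => c hc; rewrite ResE //.
have [inU outU] := multiply_ind cU (extension x) c.
case: (hc) => h; first by rewrite inU.
by rewrite outU // extensionE // germF //; exact: ball_not_both.
Qed.

Lemma extension_Res f : exists x, extension x = Res M (Ccind A N U) f.
Proof.
have [x xE] : exists x : sheaf_module M opens_total, forall c, germ x c = f c^-1.
  by exists (mk_section (U := opens_total) (MP_germ f)).
exists (@restrict M opens_total U (@opens_subset U) x); apply: MP_eq_decided => c hc.
rewrite ResE // extensionE //.
have [inU outU] := multiply_ind cU f c.
case: (hc) => h; first by rewrite inU // restrictT.
by rewrite outU // germF //; exact: ball_not_both.
Qed.

End ExtensionByZero.

Lemma germ_is_SM : is_SM (S := germ_eqsheaf M) extension.
Proof.
split=> [U cU|U cU|U V cU cV h x|b U V cU cV h x].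
- exact: extension_inj.
- apply/seteqP; split=> _ [x _ <-].
    by exists (extension cU x) => //; exact: Res_extension.
  by have [y yE] := extension_Res cU x; exists y.
- apply: (MP_eq_decided cV) => c hc; rewrite ResE // extensionE //.
  have [inV outV] := multiply_ind cV (extension cU x) c.
  case: (hc) => h'.
    rewrite inV // restrictT // extensionE //; left.
    exact: (subset_trans h' h).
  by rewrite outV // germF //; exact: ball_not_both.
- apply: (MP_eq_decided cV) => c hc; rewrite extensionE //=.
  have -> : c^-1 * b = (b^-1 * c)^-1 by group_eq.
  rewrite extensionE // -(image_dotK b U) -h.
  case: hc => hc; [left|right]; rewrite -ball_image; first exact: image_dotS.
  move=> _ [y cy <-] /image_dotE; rewrite invgK dotVK; exact: hc.
Qed.

End Restriction.

Lemma germ_functor_SM : is_SM_functor germ_functor.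
Proof.
exists extension; split=> [M|M M' f U cU x p]; first exact: germ_is_SM.
have [h hE] : exists h : MP (M' : Mod), forall c,
    h c^-1 = (f : ethom _ _) (extension M cU x c^-1).
  by apply: germ_MP; exact: (germ_mapP f (MP_germ (extension M cU x))).
suff -> : extension M' cU ((fmor germ_functor f : eqshom _ _) U x) = h.
  by rewrite -[p]invgK hE.
apply: (@MP_eq_decided _ U cU) => c hc; rewrite hE !extensionE //.
Qed.

(** * The etale module of sections over N0 *)

Lemma opens_eq (U V : opens N) : U = V :> set P -> U = V.
Proof.
case: U V => U hU [V hV] /= E; subst V; congr Opens; exact: Prop_irrelevance.
Qed.

Section SheafSections.
Variable S : eqsheaf A N L.

Lemma res_irrelevance (U V : opens N) (h h' : V `<=` U) (x : S U) :
  res S h x = res S h' x.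
Proof. by rewrite (Prop_irrelevance h h'). Qed.

Lemma sheaf_separated (U : opens N) (x y : S U) :
  (forall z, (U : set P) z -> exists (V : opens N) (h : V `<=` U),
     (V : set P) z /\ res S h x = res S h y) -> x = y.
Proof.
move=> loc.
pose C := [set V : opens N | exists h : V `<=` U, res S h x = res S h y].
have CU (V : opens N) : C V -> V `<=` U by case.
have cov : U `<=` [set z | exists2 V : opens N, C V & (V : set P) z].
  by move=> z /loc[V [h [Vz E]]]; exists V => //; exists h.
pose r V (CV : C V) := res S (CU V CV) x.
have compat (V W O : opens N) (CV : C V) (CW : C W) (hV : O `<=` V)
    (hW : O `<=` W) : res S hV (r V CV) = res S hW (r W CW).
  have hO : O `<=` U by exact: (subset_trans hV (CU V CV)).
  by rewrite /r !(res_comp _ _ hO).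
have [z [_ zuniq]] := sheaf_glue CU cov compat.
rewrite -(zuniq x) // -(zuniq y) // => V CV; have [h E] := CV.
by rewrite /r !(res_irrelevance (CU V CV) h).
Qed.

Lemma section_empty (U : opens N) (x y : S U) : U `<=` set0 -> x = y.
Proof. by move=> U0; apply: sheaf_separated => z /U0. Qed.

(** The section is glued over the covering by the open subsets of [V] and those
    disjoint from [V]. Allowing all subsets of [V], and not only [V] itself,
    avoids transporting [x] along an equality of open sets. *)
Lemma zero_extension (U V : opens N) (VU : V `<=` U) (cV : compact V)
  (x : S V) : exists y : S U, res S VU y = x /\
    forall (W : opens N) (h : W `<=` U), W `&` V `<=` set0 -> res S h y = 0%R.
Proof.
pose C := [set W : opens N | W `<=` V \/ (W `<=` U /\ W `&` V `<=` set0)].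
have CU (W : opens N) : C W -> W `<=` U.
  by case=> [h|[]//]; exact: (subset_trans h VU).
have cov : U `<=` [set z | exists2 W : opens N, C W & (W : set P) z].
  move=> z Uz; have [Vz|nVz] := pselect ((V : set P) z).
    by exists V => //; left.
  exists (opens_diff U cV) => //; right; split; first by move=> y [].
  by move=> y [[]].
pose r (W : opens N) (CW : C W) : S W :=
  if pselect (W `<=` V) is left h then res S h x else 0%R.
have compat (W W' O : opens N) (CW : C W) (CW' : C W') (hW : O `<=` W)
    (hW' : O `<=` W') : res S hW (r W CW) = res S hW' (r W' CW').
  rewrite /r; case: pselect => [h|n]; case: pselect => [h'|n'].
  - have hO : O `<=` V by exact: (subset_trans hW h).
    by rewrite !(res_comp _ _ hO).
  - apply: section_empty; case: CW' => [/n' //|[_ d]] z Oz.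
    by apply: d; split; [exact: hW'|exact/h/hW].
  - apply: section_empty; case: CW => [/n //|[_ d]] z Oz.
    by apply: d; split; [exact: hW|exact/h'/hW'].
  - by rewrite !linear0.
have [y [yP _]] := sheaf_glue CU cov compat.
have CV : C V by left.
exists y; split=> [|W h d].
  rewrite (res_irrelevance VU (CU V CV)) yP /r.
  by case: pselect => [h|[]//]; rewrite res_id.
have CW : C W by right.
rewrite (res_irrelevance h (CU W CW)) yP /r; case: pselect => // hWV.
by apply: section_empty => z Wz; apply: d; split=> //; exact: hWV.
Qed.

(** The two open subsets are equal as sets, but need not be the same record; this
    also covers the transport of a section between them. *)
Lemma sact1_res (U V : opens N) (h : V = dot 1 @` U :> set P) (i : V `<=` U)
  (x : S U) : sact S h x = res S i x.
Proof.
have E : V = U by apply: opens_eq; rewrite h image_dot1.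
by subst V; rewrite sact1 res_id.
Qed.

Lemma sact_irrelevance b c (U V : opens N) (h : V = dot b @` U :> set P)
  (h' : V = dot c @` U :> set P) (x : S U) : b = c ->
  sact S h x = sact S h' x.
Proof. by move=> E; subst c; rewrite (Prop_irrelevance h h'). Qed.

Definition to_ball (c : P) : {linear S N0 -> S (ball_opens c)} :=
  sact S (b := c) (U := N0) (V := ball_opens c) erefl.

Lemma from_ball_subproof c : N0s = dot c^-1 @` (ball_opens c : set P).
Proof. by rewrite /= image_dotK. Qed.

Definition from_ball (c : P) : {linear S (ball_opens c) -> S N0} :=
  sact S (from_ball_subproof c).

Lemma to_ballK c x : from_ball c (to_ball c x) = x.
Proof.
have h : N0s = dot (c^-1 * c) @` N0 by rewrite mulVg image_dot1.
have h1 : N0s = dot 1 @` N0 by rewrite image_dot1.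
rewrite -(sactM _ _ h) (sact_irrelevance h h1) ?mulVg //.
exact: sact1.
Qed.

Lemma from_ballK c x : to_ball c (from_ball c x) = x.
Proof.
have h : ball_opens c = dot (c * c^-1) @` ball_opens c :> set P.
  by rewrite mulgV image_dot1.
have h1 : ball_opens c = dot 1 @` ball_opens c :> set P by rewrite image_dot1.
rewrite -(sactM _ _ h) (sact_irrelevance h h1) ?mulgV //.
exact: sact1.
Qed.

(** The characterization of the result [y] of the action of [b] on [x]; the two
    conditions determine [y] when [b] is in [Pplus], since [ball b] and its
    complement cover [N0]. *)
Definition is_zero_extension (b : P) (x y : S N0) : Prop :=
  (forall h : ball_opens b `<=` N0, res S h y = to_ball b x) /\
  (forall (W : opens N) (h : W `<=` N0), W `&` ball b `<=` set0 ->
     res S h y = 0%R).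

Lemma zero_extension_uniq b x y y' : is_zero_extension b x y ->
  is_zero_extension b x y' -> Pplus b -> y = y'.
Proof.
move=> [yb y0] [y'b y'0] hb; apply: sheaf_separated => z hz.
have [bz|nbz] := pselect (ball b z).
  have h : ball_opens b `<=` N0 by apply/PplusP.
  by exists (ball_opens b), h; rewrite yb y'b.
have h : opens_diff N0 (@compact_ball b) `<=` N0 by move=> t [].
exists (opens_diff N0 (@compact_ball b)), h; split=> //.
by rewrite y0 ?y'0 // => t [[]].
Qed.

Definition push_fun (b : P) (x : S N0) : S N0 :=
  xget 0%R [set y | Pplus b /\ is_zero_extension b x y].

Lemma push_funP b x : Pplus b -> is_zero_extension b x (push_fun b x).
Proof.
move=> hb; have h : ball_opens b `<=` N0 by apply/PplusP.
have [y [y1 y2]] := zero_extension h (@compact_ball b) (to_ball b x).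
have yP : is_zero_extension b x y.
  by split=> // h'; rewrite (res_irrelevance h' h).
by rewrite /push_fun; case: xgetP => [y' _ []//|/(_ y)[]].
Qed.

Lemma push_fun_out b x : ~ Pplus b -> push_fun b x = 0%R.
Proof. by move=> nb; rewrite /push_fun; case: xgetP => // y _ [/nb]. Qed.

Lemma push_fun_eq b x y : Pplus b -> is_zero_extension b x y ->
  push_fun b x = y.
Proof. by move=> hb yP; apply: zero_extension_uniq (push_funP x hb) yP hb. Qed.

Lemma push_fun_linear b : linear (push_fun b).
Proof.
move=> a x y; have [hb|nb] := pselect (Pplus b); last first.
  by rewrite !push_fun_out // GRing.scaler0 GRing.addr0.
have [x1 x2] := push_funP x hb; have [y1 y2] := push_funP y hb.
apply: push_fun_eq => //; split=> [h|W h d]; first by rewrite !linearP x1 y1.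
by rewrite linearP x2 // y2 // GRing.scaler0 GRing.addr0.
Qed.

Definition push b : {linear S N0 -> S N0} := mk_linear (@push_fun_linear b).

Lemma push_eq b x y : Pplus b -> is_zero_extension b x y -> push b x = y.
Proof. exact: push_fun_eq. Qed.

Lemma push_disjoint b x (W : opens N) (h : W `<=` N0) : Pplus b ->
  W `&` ball b `<=` set0 -> res S h (push b x) = 0%R.
Proof. by move=> /(push_funP x)[_]; exact. Qed.

Lemma push_res b x (U V : opens N) (h : V = dot b @` U :> set P)
  (i : U `<=` N0) (j : V `<=` N0) : Pplus b ->
  res S j (push b x) = sact S h (res S i x).
Proof.
move=> hb; have bN : ball_opens b `<=` N0 by apply/PplusP.
have Vb : V `<=` ball_opens b by rewrite h; exact: image_dotS.
rewrite -(res_comp bN Vb j); have [-> _] := push_funP x hb.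
exact: (sact_res (e := S)).
Qed.

Lemma push1 x : push 1 x = x.
Proof.
have h1 : Pplus 1 by exact: (N0_Pplus gL (N01 gN0)).
apply: push_eq => //; split=> [h|W h d]; first by rewrite /to_ball (sact1_res _ h).
apply: section_empty => z Wz; apply: d; split=> //; rewrite ball1; exact: h.
Qed.

Lemma pushM b c x : Pplus b -> Pplus c -> push (b * c) x = push b (push c x).
Proof.
move=> hb hc; have hbc := PplusM gL gN0 hb hc.
have cN : ball_opens c `<=` N0 by apply/PplusP.
apply: push_eq => //; split=> [h|W h d].
  have E : ball_opens (b * c) = dot b @` ball_opens c :> set P by exact: image_dotM.
  have E1 : ball_opens c = dot c @` N0 :> set P by [].
  rewrite (push_res _ E cN) // (push_res x E1 (@subset_refl _ _)) // res_id.
  by rewrite -(sactM _ _ (erefl : ball_opens (b * c) = dot (b * c) @` N0 :> set P)).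
apply: sheaf_separated => z Wz.
have [bz|nbz] := pselect (ball b z); last first.
  exists (opens_diff W (@compact_ball b)).
  have i : opens_diff W (@compact_ball b) `<=` W by move=> t [].
  exists i; split=> //.
  have j : opens_diff W (@compact_ball b) `<=` N0 by exact: (subset_trans i h).
  by rewrite (res_comp _ _ j) push_disjoint ?linear0 // => t [[]].
pose V := opens_inter W (ball_opens b).
have i : V `<=` W by move=> t [].
exists V, i; split=> //.
have j : V `<=` N0 by exact: (subset_trans i h).
pose U := image_opens b^-1 V.
have E : V = dot b @` U :> set P by rewrite /= image_dotVK.
have k : U `<=` N0.
  by move=> t /image_dotE; rewrite invgK => -[_ /image_dotE]; rewrite dotK.
rewrite (res_comp _ _ j) (push_res _ E k) // push_disjoint // ?linear0 //.
move=> t [/image_dotE]; rewrite invgK => -[Wt _] /image_dotE ct.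
apply: (d (dot b t)); split=> //.
by rewrite /ball image_dotM; apply/image_dotE; rewrite dotK; apply/image_dotE.
Qed.

Definition section_pmodule : pmodule A L N0 :=
  PModule push1 pushM push_fun_out.

Definition pull (p : P) (h : ball_opens p `<=` N0) : {linear S N0 -> S N0} :=
  from_ball p \o res S h.

Lemma coset_disjoint t u w : L t -> N0s u -> N0s w ->
  ~ conjset t N0 (u^-1 * w) -> ball (u * t) `&` ball (w * t) `<=` set0.
Proof.
move=> Lt /opens_subset Nu /opens_subset Nw nuw y [uy wy]; apply: nuw.
move: uy wy; rewrite !ball_conjP // => uy /conj_cosetC wy.
exact: (conj_coset_trans uy wy).
Qed.

Lemma pull_is_psi t (tN : ball_opens t `<=` N0) : Lplus t ->
  is_psi (M := section_pmodule) t (pull tN).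
Proof.
move=> ht; have tP := Lplus_Pplus gN0 ht; have Lt : L t by case: ht.
split=> [m|u m hu nu].
  by rewrite /pull /=; have [-> _] := push_funP m tP; rewrite to_ballK.
have uP := N0_Pplus gL hu.
change (from_ball t (res S tN (push u (push t m))) = 0%R).
rewrite -pushM // push_disjoint ?linear0 //; first exact: (PplusM gL gN0).
have := @coset_disjoint t 1 u Lt (N01 gN0) hu.
by rewrite invg1 !mul1g; apply.
Qed.

(** By the sheaf axiom, [S N0] is the product of the sections over the balls of
    the elements [u * t], for [u] in [J]; the projections are restrictions. *)
Lemma section_etale : etale section_pmodule.
Proof.
apply: (etaleI gL gN0) => t ht; have tP := Lplus_Pplus gN0 ht.
have tN : ball_opens t `<=` N0 by apply/PplusP.
have Lt : L t by case: ht.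
have [J JP] := coset_representatives_exist ht; have [uJ J0 JU] := JP.
exists (pull tN), J; split=> //; first exact: pull_is_psi.
move=> m.
change (m = \sum_(u <- J) push (u * t)%g (pull tN (push u^-1%g m)))%R.
apply: sheaf_separated => z hz.
have [u [[uJ' huz] _]] := JU z hz; have hu := J0 _ uJ'.
have utP := Pplus_mul hu ht.
have i : ball_opens (u * t) `<=` N0 by apply/PplusP.
exists (ball_opens (u * t)), i; split.
  by apply/ball_conjP => //; exact: opens_subset hu.
rewrite linear_sum (bigD1_seq u) // big1_seq; last first.
  move=> v /andP[vu vJ]; have hv := J0 _ vJ.
  rewrite push_disjoint //; first exact: (Pplus_mul hv ht).
  apply: (@coset_disjoint t u v Lt hu hv) => huv; case/eqP: vu.
  have [w [_ wu]] := JU z hz.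
  rewrite -(wu u) // -(wu v) //; split=> //.
  exact: (conj_coset_trans (conj_cosetC huv) huz).
have hV := N0V gN0 hu; have uV := N0_Pplus gL hV.
have [-> _] := push_funP (pull tN (push u^-1 m)) utP.
have E : ball_opens t = dot u^-1 @` ball_opens (u * t) :> set P.
  by rewrite /= -/(ball _) ball_image mulKg.
rewrite /pull /= (push_res _ E i) // /from_ball /to_ball.
have E1 : N0s = dot (t^-1 * u^-1) @` (ball_opens (u * t) : set P).
  by rewrite -invgM /= image_dotK.
rewrite -(sactM _ _ E1).
have E2 : ball_opens (u * t) =
    dot (u * t * (t^-1 * u^-1)) @` ball_opens (u * t) :> set P.
  by rewrite -invgM mulgV image_dot1.
have E3 : ball_opens (u * t) = dot 1 @` ball_opens (u * t) :> set P.
  by rewrite image_dot1.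
rewrite -(sactM _ _ E2) (sact_irrelevance E2 E3) ?sact1 ?GRing.addr0 //.
group_eq.
Qed.

Definition section_etmod : Mod := EtMod section_etale.

Lemma pactE b x : pact section_etmod b x = push b x. Proof. by []. Qed.

(** Both sides are left inverse to the action of [p] and vanish on sections
    supported on the other cosets; [psi] is unique with these properties. *)
Lemma contract_section p (h : ball_opens p `<=` N0) (x : S N0) : Pplus p ->
  contract section_etmod p x = pull h x.
Proof.
case=> u [t [hu ht pE]]; have tP := Lplus_Pplus gN0 ht.
have tN : ball_opens t `<=` N0 by apply/PplusP.
have Lt : L t by case: ht.
subst p; rewrite contractE //.
rewrite -(is_psi_uniq gL gN0 section_etale ht (pull_is_psi tN ht)) pactE.
have uV := N0_Pplus gL (N0V gN0 hu).
have E : ball_opens t = dot u^-1 @` ball_opens (u * t) :> set P.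
  by rewrite /= -/(ball _) ball_image mulKg.
rewrite /pull /= (push_res _ E h) // /from_ball.
have E1 : N0s = dot (t^-1 * u^-1) @` (ball_opens (u * t) : set P).
  by rewrite -invgM /= image_dotK.
rewrite -(sactM _ _ E1); apply: sact_irrelevance; group_eq.
Qed.

End SheafSections.

Section SectionMorphism.
Variables (S S' : eqsheaf A N L) (f : eqshom S S').

Lemma eqshom_push b x : Pplus b -> f N0 (push S b x) = push S' b (f N0 x).
Proof.
move=> hb; apply/esym/push_eq => //; have [h1 h2] := push_funP x hb.
split=> [h|W h d]; first by rewrite -eqshom_res h1 /to_ball eqshom_act.
by rewrite -eqshom_res h2 ?linear0.
Qed.

Definition section_hom : ethom (section_etmod S) (section_etmod S') :=
  @EtHom _ _ _ _ (section_etmod S) (section_etmod S') (f N0) eqshom_push.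

End SectionMorphism.

Definition section_functor :
  functor (EquivariantSheaves A N L) (EtaleModules A L N0).
Proof.
refine (@Functor (EquivariantSheaves A N L) (EtaleModules A L N0)
  section_etmod section_hom _ _) => *; exact: ethom_eqP.
Defined.

Lemma section_functor_sections : is_sections_functor section_functor.
Proof.
exists (fun S : EquivariantSheaves A N L =>
  idfun : {linear (section_etmod S : etmod A L N0) -> (S : eqsheaf A N L) N0}).
split=> // S; split; first by exists idfun.
move=> b m hb; split=> [V h hV|V hV d] /=.
  have E : V = ball_opens b by apply: opens_eq.
  subst V; have [H _] := push_funP m hb.
  by transitivity (to_ball S b m); [exact: H|exact: sact_irrelevance].
by apply: push_disjoint => //; rewrite /ball d.
Qed.

(** * The equivalence of categories *)

Section Unit.
Variable M : Mod.

Definition unit_germ (m : M) (c : P) : M :=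
  if `[< Pplus c >] then contract M c m else 0%R.

Lemma unit_germP m : is_germ N0s (unit_germ m).
Proof.
split=> [c|c p hp]; rewrite -PplusP => hc; rewrite /unit_germ.
  by case: asboolP.
have hcp := PplusM gL gN0 hc hp.
by case: asboolP => // _; case: asboolP => // _; rewrite contractM.
Qed.

Definition unit_fun (m : M) : germ_eqsheaf M N0 := mk_section (unit_germP m).

Lemma unit_fun_linear : linear unit_fun.
Proof.
move=> a x y; apply: germ_inj; apply/funext => c.
rewrite germ_linear /germ /= /unit_germ.
by case: asboolP => _; rewrite ?linearP // GRing.scaler0 GRing.addr0.
Qed.

Definition unit_map : {linear M -> germ_eqsheaf M N0} := mk_linear unit_fun_linear.

Lemma unit_mapE m c : Pplus c -> germ (unit_map m) c = contract M c m.
Proof. by rewrite /germ /= /unit_germ; case: asboolP. Qed.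

(** Choose [k] such that [ball (z * s ^+ k)] avoids [ball b]. Decomposing [m] at
    radius [k] writes [pact M b m] as a sum of elements [pact M (w * s ^+ k) m']
    with [w] in [ball b], and these contract to [0] on [ball (z * s ^+ k)]. *)
Lemma contract_disjoint b m z : Pplus b -> N0s z -> ~ ball b z ->
  exists k, forall c, ball c `<=` ball (z * s ^+ k) ->
    contract M c (pact M b m) = 0%R.
Proof.
move=> hb hz nbz; have Nz := opens_subset hz.
have [k kP] := @ball_basis (opens_diff N0 (@compact_ball b)) z (conj hz nbz).
have hzk := Pplus_ball k hz.
have zk0 : contract M (z * s ^+ k) (pact M b m) = 0%R.
  have ht := Lplus_sk k.
  have [J JP] := coset_representatives_exist ht; have [_ J0 _] := JP.
  rewrite [m](contract_resolution _ ht JP) !linear_sum.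
  rewrite big1_seq // => u /andP[_ /J0 hu].
  move: (contract _ _ m) => m'.
  have hus := Pplus_ball k hu.
  rewrite -pactM //; have [w hw E] := shift_sk k hb hu.
  have hl := Pplus_lpart hb.
  have bw : ball b w.
    have : ball (w * s ^+ k * lpart b) `<=` ball b.
      by rewrite -E; exact: (ballMr hus).
    apply; rewrite -mulgA; apply/ball_conjP.
    - exact: opens_subset hw.
    - by apply: LM; [exact: skL|case: hl].
    - by rewrite mulVg conjsetE mulg1 mulVg; exact: N01 gN0.
  rewrite E pactM; last 2 first.
  - exact: Pplus_ball.
  - exact: (Lplus_Pplus gN0 hl).
  rewrite contract_translate //; case: asboolP => // h.
  have /kP[_ []//] : ball (z * s ^+ k) w by apply/ball_conjP => //; exact: skL.
exists k => c /ball_subP hc.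
by rewrite -[c](mulVKg (z * s ^+ k)) contractM // zk0 linear0.
Qed.

Lemma unit_map_act b m : Pplus b ->
  unit_map (pact M b m) = push (germ_eqsheaf M) b (unit_map m).
Proof.
move=> hb; apply/esym/push_eq => //; split=> [h|W h d].
  apply: section_eq => c cb; have cP : Pplus c.
    by apply/PplusP; exact: (subset_trans cb h).
  rewrite restrictT // unit_mapE // [RHS]translateE unit_mapE; last first.
    by apply/ball_subP.
  rewrite -[in LHS](mulVKg b c) contractM ?contractK //.
  by apply/ball_subP.
apply: section_eq_local => z Wz.
have hz : N0s z by exact: h.
have nbz : ~ ball b z by move=> bz; apply: (d z); split.
have [k kP] := contract_disjoint m hb hz nbz.
exists (ball_opens (z * s ^+ k)); split.
  by apply: ball_sk_center; exact: opens_subset hz.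
move=> c cW cz; rewrite restrictT // unit_mapE ?germ0 ?kP //.
by apply/PplusP; exact: (subset_trans cW h).
Qed.

Definition unit_hom : ethom M (section_etmod (germ_eqsheaf M)) :=
  @EtHom _ _ _ _ M (section_etmod (germ_eqsheaf M)) unit_map unit_map_act.

Lemma unit_bijective : bijective unit_map.
Proof.
have h1 : Pplus 1 by exact: (N0_Pplus gL (N01 gN0)).
exists (fun x => germ x 1) => [m|x]; first by rewrite unit_mapE // contract1.
apply: section_eq => c /PplusP cP; rewrite unit_mapE //.
by rewrite -{2}[c]mul1g germM // ball1.
Qed.

End Unit.

Section Counit.
Variable S : eqsheaf A N L.

Local Notation GS := (section_etmod S).

(** The counit goes from the sheaf of [S N0] to [S]; its inverse, constructed
    here, can be written down without gluing. *)
Definition counit_germ (U : opens N) (x : S U) (c : P) : GS :=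
  if pselect (ball_opens c `<=` U) is left h then from_ball S c (res S h x)
  else 0%R.

Lemma counit_germE (U : opens N) (x : S U) c (h : ball_opens c `<=` U) :
  counit_germ x c = from_ball S c (res S h x).
Proof.
rewrite /counit_germ; case: pselect => // h'.
by rewrite (res_irrelevance h' h).
Qed.

Lemma counit_germP (U : opens N) (x : S U) : is_germ (M := GS) U (counit_germ x).
Proof.
split=> [c nc|c p hp cU]; first by rewrite /counit_germ; case: pselect.
have pN : ball_opens p `<=` N0 by apply/PplusP.
have cpc : ball_opens (c * p) `<=` ball_opens c by exact: ballMr.
have cpU : ball_opens (c * p) `<=` U by exact: (subset_trans cpc cU).
rewrite (counit_germE x cU) (counit_germE x cpU) (contract_section pN) //.
have E : ball_opens p = dot c^-1 @` ball_opens (c * p) :> set P.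
  by rewrite /= -/(ball _) ball_image mulKg.
rewrite /pull /= /from_ball (sact_res (e := S) _ E cpc).
have E1 : N0s = dot (p^-1 * c^-1) @` (ball_opens (c * p) : set P).
  by rewrite -invgM /= image_dotK.
rewrite -(sactM _ _ E1) (res_comp _ _ cpU).
apply: sact_irrelevance; group_eq.
Qed.

Definition counit_fun (U : opens N) (x : S U) : germ_eqsheaf GS U :=
  mk_section (counit_germP x).

Lemma counit_fun_linear U : linear (@counit_fun U).
Proof.
move=> a x y; apply: section_eq => c cU.
by rewrite germ_linear /germ /= !(counit_germE _ cU) !linearP.
Qed.

Definition counit_map U : {linear S U -> germ_eqsheaf GS U} :=
  mk_linear (@counit_fun_linear U).

Lemma counit_mapE (U : opens N) (x : S U) c (h : ball_opens c `<=` U) :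
  germ (counit_map U x) c = from_ball S c (res S h x).
Proof. exact: counit_germE. Qed.

Lemma counit_map_res (U V : opens N) (i : V `<=` U) x :
  counit_map V (res S i x) = res (germ_eqsheaf GS) i (counit_map U x).
Proof.
apply: section_eq => c cV; have cU : ball_opens c `<=` U.
  exact: (subset_trans cV i).
by rewrite restrictT // (counit_mapE _ cV) (counit_mapE _ cU) (res_comp _ _ cU).
Qed.

Lemma counit_map_act b (U V : opens N) (h : V = dot b @` U :> set P) x :
  counit_map V (sact S h x) = sact (germ_eqsheaf GS) h (counit_map U x).
Proof.
apply: section_eq => c cV; rewrite [RHS]translateE.
have cU : ball_opens (b^-1 * c) `<=` U.
  by rewrite /= image_dotM -(image_dotK b U) -h; exact: image_dotS.
rewrite (counit_mapE _ cV) (counit_mapE _ cU).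
have E : ball_opens c = dot b @` ball_opens (b^-1 * c) :> set P.
  by rewrite /= image_dotM image_dotVK.
rewrite (sact_res (e := S) h E cU) /from_ball.
have E1 : N0s = dot (c^-1 * b) @` (ball_opens (b^-1 * c) : set P).
  by rewrite /= image_dotM -/(ball _) ball_image mulVKg image_dotK.
rewrite -(sactM _ _ E1); apply: sact_irrelevance; group_eq.
Qed.

Definition counit_hom : eqshom S (germ_eqsheaf GS) :=
  @EqsHom _ _ _ _ S (germ_eqsheaf GS) counit_map counit_map_res counit_map_act.

Lemma counit_injective (U : opens N) : injective (counit_map U).
Proof.
move=> x y E; apply: sheaf_separated => z Uz; have [k kP] := ball_basis Uz.
exists (ball_opens (z * s ^+ k)), kP; split.
  by apply: ball_sk_center; exact: opens_subset Uz.
rewrite -[LHS]from_ballK -[RHS]from_ballK; congr (to_ball _ _ _).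
by rewrite -!counit_mapE E.
Qed.

(** The germs of [g], moved back to their balls, are sections of [S] that agree
    on smaller balls, hence on intersections; they glue to a preimage of [g]. *)
Lemma counit_surjective (U : opens N) (g : germ_eqsheaf GS U) :
  exists x, counit_map U x = g.
Proof.
pose gb c : S (ball_opens c) := to_ball S c (germ g c).
have gb_res c d (h : ball_opens d `<=` ball_opens c) : ball c `<=` U ->
    res S h (gb c) = gb d.
  move=> cU; have /ball_subP := h; set p := c^-1 * d => hp.
  have pN : ball_opens p `<=` N0 by apply/PplusP.
  have dE : d = c * p by rewrite mulVKg.
  have E : ball_opens d = dot c @` ball_opens p :> set P.
    by rewrite /= -/(ball _) ball_image -dE.
  have gd : germ g d = pull S pN (germ g c).
    by rewrite [in LHS]dE germM // (contract_section pN).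
  rewrite /gb gd /to_ball (sact_res (e := S) _ E pN) /pull /= /from_ball.
  have E1 : ball_opens d = dot (d * p^-1) @` ball_opens p :> set P.
    by rewrite dE mulgK /= -/(ball _) ball_image.
  by rewrite -(sactM _ _ E1); apply: sact_irrelevance; rewrite dE mulgK.
have gb_compat c d (O : opens N) (h : O `<=` ball_opens c)
    (h' : O `<=` ball_opens d) : ball c `<=` U -> ball d `<=` U ->
    res S h (gb c) = res S h' (gb d).
  move=> cU dU; apply: sheaf_separated => z Oz.
  have [k kP] := ball_basis Oz; set e := z * s ^+ k in kP.
  have ec : ball_opens e `<=` ball_opens c by exact: (subset_trans kP h).
  have ed : ball_opens e `<=` ball_opens d by exact: (subset_trans kP h').
  exists (ball_opens e), kP; split.
    by apply: ball_sk_center; exact: opens_subset Oz.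
  by rewrite (res_comp _ _ ec) (res_comp _ _ ed) !gb_res.
pose C := [set V : opens N | exists c, V = ball c :> set P /\ ball c `<=` U].
have CU (V : opens N) : C V -> V `<=` U by case=> c [->].
have cov : U `<=` [set z | exists2 V : opens N, C V & (V : set P) z].
  move=> z Uz; have [k kP] := ball_basis Uz.
  exists (ball_opens (z * s ^+ k)); first by exists (z * s ^+ k).
  by apply: ball_sk_center; exact: opens_subset Uz.
pose r (V : opens N) (CV : C V) : S V :=
  let: exist c h := cid CV in sact S h.1 (germ g c).
have rE c (h : ball c = dot c @` N0) : sact S (V := ball_opens c) h (germ g c) = gb c.
  exact: sact_irrelevance.
have compat (V W O : opens N) (CV : C V) (CW : C W) (hV : O `<=` V)
    (hW : O `<=` W) : res S hV (r V CV) = res S hW (r W CW).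
  rewrite /r; case: (cid CV) => c [Ec cU] /=; case: (cid CW) => d [Ed dU] /=.
  have EV : V = ball_opens c by apply: opens_eq.
  have EW : W = ball_opens d by apply: opens_eq.
  by subst V W; rewrite !rE; exact: gb_compat.
have [x [xP _]] := sheaf_glue CU cov compat.
exists x; apply: section_eq => c cU.
have CV : C (ball_opens c) by exists c.
have cU' : ball_opens c `<=` U by [].
rewrite (counit_mapE x cU') (res_irrelevance cU' (CU _ CV)) xP /r.
case: (cid CV) => d [Ed dU] /=.
have E : ball_opens c = ball_opens d by apply: opens_eq.
have cd : ball_opens c `<=` ball_opens d by rewrite -E.
suff H (e : ball_opens c = dot d @` N0 :> set P) :
    sact S e (germ g d) = gb c.
  transitivity (from_ball S c (gb c)); last exact: to_ballK.
  congr (from_ball S c _). exact: H.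
rewrite -(gb_res d c cd dU).
have E1 : ball_opens c = dot 1 @` ball_opens d :> set P by rewrite image_dot1 -E.
have E2 : ball_opens c = dot (1 * d) @` N0 :> set P by rewrite mul1g.
rewrite -(sact1_res E1 cd) /gb /to_ball -(sactM _ _ E2).
by apply: sact_irrelevance; rewrite mul1g.
Qed.

Lemma counit_bijective (U : opens N) : bijective (counit_map U).
Proof.
have [h hP] := choice (@counit_surjective U).
by exists h => // x; apply: counit_injective; rewrite hP.
Qed.

End Counit.

Lemma eqshom_iso (S S' : eqsheaf A N L) (f : eqshom S S') :
  (forall U, bijective (f U)) -> @isomorphism (EquivariantSheaves A N L) S S' f.
Proof.
move=> bf.
have H U : exists g : {linear S' U -> S U}, cancel (f U) g /\ cancel g (f U).
  exact: inverse_linear.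
pose g U := projT1 (cid (H U)).
have fK U : cancel (f U) (g U) by rewrite /g; case: (cid (H U)) => h [].
have gK U : cancel (g U) (f U) by rewrite /g; case: (cid (H U)) => h [].
have gres (U V : opens N) (i : V `<=` U) x : g V (res S' i x) = res S i (g U x).
  by apply: (can_inj (fK V)); rewrite gK eqshom_res gK.
have gact b (U V : opens N) (h : V = dot b @` U :> set P) x :
    g V (sact S' h x) = sact S h (g U x).
  by apply: (can_inj (fK V)); rewrite gK eqshom_act gK.
exists (@EqsHom _ _ _ _ S' S g gres gact).
by split; apply: eqshom_eqP => U x /=; [exact: fK|exact: gK].
Qed.

Lemma germ_section_equivalence :
  inverse_equivalences germ_functor section_functor.
Proof.
pose theta (S : EquivariantSheaves A N L) :
  hom S (germ_functor (section_functor S)) := counit_hom S.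
have isoS S : isomorphism (theta S).
  by apply: eqshom_iso => U; exact: counit_bijective.
have nat S S' (f : hom S S') :
    comp (fmor germ_functor (fmor section_functor f)) (theta S) =
    comp (theta S') f.
  apply: eqshom_eqP => U x; apply: section_eq => c cU.
  change (f N0 (germ (counit_map S U x) c) = germ (counit_map S' U (f U x)) c).
  have cU' : ball_opens c `<=` U by [].
  rewrite (counit_mapE _ cU') [RHS](counit_mapE _ cU') -eqshom_res.
  exact: eqshom_act.
exists unit_hom, (fun S => projT1 (cid (isoS S))); split.
- move=> M M' f; apply: ethom_eqP => m; apply: section_eq => c /PplusP cP.
  change (f (germ (unit_map M m) c) = germ (unit_map M' (f m)) c).
  by rewrite !unit_mapE // ethom_contract.
- move=> S S' f.
  case: (cid (isoS S)) => e [ce ec]; case: (cid (isoS S')) => e' [ce' ec'].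
  change (comp f e = comp e' (fmor germ_functor (fmor section_functor f))).
  rewrite -[LHS]comp1m -ce' -[RHS]compm1 -ec -!compmA; congr comp.
  by rewrite !compmA nat.
- by move=> M; apply: ethom_iso; exact: unit_bijective.
- move=> S; case: (cid (isoS S)) => e [ce ec] /=.
  by exists (theta S).
Qed.

End Balls.

Theorem theorem3p32 (A : comPzRingType) (P : topGroupType) (N L : set P)
    (N0 : opens N) (s : P)
    (locP : locally_profinite P)
    (PNL : semidirect_product N L)
    (N0prof : profinite_subgroup N0)
    (hs : contracting N L N0 s) :
  abelian (EtaleModules A L N0) /\
  abelian (EquivariantSheaves A N L) /\
  exists (F : functor (EtaleModules A L N0) (EquivariantSheaves A N L))
         (G : functor (EquivariantSheaves A N L) (EtaleModules A L N0)),
    is_SM_functor F /\ is_sections_functor G /\ inverse_equivalences F G.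
Proof.
have equiv := germ_section_equivalence locP PNL N0prof hs A.
have abE : abelian (EtaleModules A L N0).
  apply: etale_abelian (gL PNL) (gN0 N0prof) _ => t.
  exact: (coset_representatives_exist PNL N0prof).
split=> //; split; first exact: (abelian_equivalence equiv).
eexists; eexists; split; first exact: (germ_functor_SM locP PNL N0prof hs).
by split; [exact: (section_functor_sections locP PNL N0prof A)|exact: equiv].
Qed.
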